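(* Let $(y_n)_{n\ge 0}$ be an inhomogeneous Markov chain on $\mathbb{R}^D$, with step sequence $(\gamma_n)_{n\ge1}$, operators $\mathcal L_n$ and interpolated laws $(\mu_t)_{t\ge0}$, and let $(P_t)_{t\ge 0}$ be the semigroup of a homogeneous Markov process on $\mathbb{R}^D$ with generator $\mathcal L$, domain $\mathcal D(\mathcal L)$ and semiflow $\Phi(\nu,t)=\nu P_t$, all as defined in the context. Let $d_1,N_1,N_2$ be multi-indices with $N_1\le N_2$. Assume: (1) (Convergence of generators) There exist a non-increasing sequence $(\epsilon_n)_{n\ge1}$ converging to $0$ and a constant $M_1$ (depending on $\mathscr L(y_0)$) such that for all $f\in\mathcal D(\mathcal L)\cap\mathscr C_b^{N_1}$, all $n\ge 1$ and all $y\in\mathrm{Supp}(\mathscr L(y_n))$, $$|\mathcal L f(y)-\mathcal L_nf(y)|\le M_1\,\chi_{d_1}(y)\sum_{j\le N_1}\|f^{(j)}\|_\infty\,\epsilon_n .$$ (2) (Regularity of the limit semigroup) For all $T>0$ there exists a constant $C_T$ such that, for every $t\le T$, every multi-index $j\le N_1$ and every $f\in\mathscr C_b^{N_2}$, one has $P_tf\in\mathscr C_b^{N_1}$ and $|(P_tf)^{(j)}(y)|\le C_T\sum_{i\le N_2}\|f^{(i)}\|_\infty$ for all $y\in\mathbb{R}^D$. (3) (Uniform boundedness of moments) There exists a multi-index $d\ge d_1$ such that one of the following holds: (a) there is a constant $M_2$ (depending on $\mathscr L(y_0)$) such that $\sup_{n\ge0}\mathbb{E}[\chi_d(y_n)]\le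 M_2$; or (b) there is $V:\mathbb{R}^D\to\mathbb{R}_+$ such that $\mathbb{E}[V(y_n)]<+\infty$ for all $n\ge0$, and there exist $n_0\ge1$ and $a,\alpha,\beta>0$ such that $V(y)\ge\chi_d(y)$ when $|y|>a$ and, for all $n\ge n_0$ and $y\in\mathrm{Supp}(\mathscr L(y_n))$, $\mathcal L_nV(y)\le-\alpha V(y)+\beta$. Let $$\mathscr F=\Big\{f\in\mathcal D(\mathcal L)\cap\mathscr C_b^{N_2}:\ \mathcal Lf\in\mathcal D(\mathcal L),\ \|\mathcal Lf\|_\infty+\|\mathcal L\mathcal Lf\|_\infty+\sum_{j\le N_2}\|f^{(j)}\|_\infty\le1\Big\}.$$ Let $\pi$ be a probability measure on $\mathbb{R}^D$, $v,M_3>0$ constants ($M_3$ may depend on $\mathscr L(y_0)$) and $\mathscr G$ a class of functions. (i) Suppose $\mathscr G\subseteq\mathscr F$ and, for every probability measure $\nu$ and all $t>0$, $d_{\mathscr G}(\Phi(\nu,t),\pi)\le d_{\mathscr G}(\nu,\pi)M_3e^{-vt}$. If $\lambda(\gamma,\epsilon)>0$ then, for any $u<\lambda(\gamma,\epsilon)\wedge v$, there exists a constant $M_5$ such that, for all $t>t_0:=(v-u)^{-1}\log(1\vee M_3)$, $$d_{\mathscr G}(\mu_t,\pi)\le\big(M_5+d_{\mathscr G}(\mu_0,\pi)\big)e^{-ut}.$$ (ii) Suppose there exist $r,M_4>0$ such that $d_{\mathscr G}(\Phi(\mu_s,t),\pi)\le M_3e^{-vt}$ for all $s,t>0$, and $TC_T\le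 M_4e^{rT}$ for all $T>0$, with $C_T$ the constants of (2). If $\lambda(\gamma,\epsilon)>0$ then, for any $u<v\lambda(\gamma,\epsilon)\,(r+v+\lambda(\gamma,\epsilon))^{-1}$, there exists a constant $M_5$ such that, for all $t>0$, $$d_{\mathscr F\cap\mathscr G}(\mu_t,\pi)\le M_5e^{-ut}.$$ (iii) Suppose there exist functions $\psi:\mathbb{R}_+\to\mathbb{R}_+$ and $W\in\mathscr C^0$ with $\lim_{t\to\infty}\psi(t)=0$, $\lim_{\|x\|\to\infty}W(x)=+\infty$, $\sup_{n\ge0}\mathbb{E}[W(y_n)]<\infty$, and such that for every probability measure $\nu$ and all $t\ge0$, $d_{\mathscr G}(\Phi(\nu,t),\pi)\le\nu(W)\psi(t)$. If convergence in $d_{\mathscr G}$ implies weak convergence, then $\mu_t$ converges weakly to $\pi$ as $t\to\infty$.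
   Context: Multi-indices: elements $N=(N_1,\dots,N_D)\in\mathbb{N}^D$, ordered componentwise; an integer $N$ is identified with $(N,\dots,N)$. $\mathscr C^N$ is the set of $f:\mathbb{R}^D\to\mathbb{R}$ that are $N_i$ times continuously differentiable in direction $i$; $f^{(N)}=\partial^{|N|}f/\partial_{x_1}^{N_1}\cdots\partial_{x_D}^{N_D}$ with $|N|=\sum_iN_i$; $\|\cdot\|_\infty$ is the sup norm; $\mathscr C_b^N$ is the set of $f\in\mathscr C^N$ with $\sum_{j\le N}\|f^{(j)}\|_\infty<\infty$; $\mathscr C_c^\infty$ is the set of smooth compactly supported functions. $\chi_N(x)=\sum_{i=1}^D\sum_{k=0}^{N_i}|x_i|^k$. $\mathscr L(X)$ is the law of $X$ and $\mathrm{Supp}$ its support; $x\wedge y=\min(x,y)$, $x\vee y=\max(x,y)$. Limit process: $(X_t)_{t\ge0}$ is a homogeneous Markov process on $\mathbb{R}^D$ with a.s. càdlàg trajectories, $P_tf(x)=\mathbb{E}[f(X_t)\mid X_0=x]$. The domain $\mathcal D(\mathcal L)$ is the set of (bounded measurable) functions $f$ for which there is a (bounded measurable) function $\mathcal Lf$ with $\lim_{t\to0}\|t^{-1}(P_tf-f)-\mathcal Lf\|_\infty=0$; $\mathcal L$ is the generator. The semiflow is $\Phi(\nu,t)=\nu P_t$ for probability measures $\nu$ and $t\ge0$. Chain: $(\gamma_n)_{n\ge1}$ is a non-increasing sequence of positive numbers converging to $0$ with $\sum_n\gamma_n=+\infty$; $\mathcal L_nf(y)=\gamma_{n+1}^{-1}\mathbb{E}[f(y_{n+1})-f(y_n)\mid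 y_n=y]$ (through the transition kernel of the chain at step $n$, whenever the expectation makes sense). Put $\tau_0=0$, $\tau_n=\sum_{k=1}^n\gamma_k$, $Y_t=y_n$ for $t\in[\tau_n,\tau_{n+1})$, $\mu_t=\mathscr L(Y_t)$. For a class $\mathscr H$ of functions, $d_{\mathscr H}(\mu,\nu)=\sup_{f\in\mathscr H}|\mu(f)-\nu(f)|$. Standing convention (relevant only to (iii)): $\mathscr F$ contains $\mathscr C_c^\infty$ up to constants, i.e. for every $g\in\mathscr C_c^\infty$ there is $\lambda>0$ with $\lambda g\in\mathscr F$. For non-increasing sequences $\gamma,\epsilon$ converging to $0$, $\lambda(\gamma,\epsilon)=-\limsup_{n\to\infty}\dfrac{\log(\gamma_n\vee\epsilon_n)}{\sum_{k=1}^n\gamma_k}$. It may equal $+\infty$, in which case the bound $v\lambda/(r+v+\lambda)$ is read as $v$. *)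

(* Defs.v *)
From HB Require Import structures.
From mathcomp Require Import all_boot all_order all_algebra.
From mathcomp Require Import all_classical all_reals all_analysis.
Set Implicit Arguments.
Unset Strict Implicit.
Unset Printing Implicit Defensive.
Import Order.TTheory GRing.Theory Num.Theory.
Import numFieldNormedType.Exports.
Local Open Scope classical_set_scope.
Local Open Scope ring_scope.

(* R^D is 'rV[R]_D (its norm is the max norm) with its Borel sigma-algebra. *)
HB.instance Definition _ (R : realType) (D : nat) :=
  @isMeasurable.Build (sigma_display (@open 'rV[R]_D)) 'rV[R]_D
    <<s @open 'rV[R]_D >> (@sigma_algebra0 _ setT _) (@sigma_algebraC _ _)
    (@sigma_algebra_bigcup _ setT _).

Section MultiIndices.
Context (R : realType) (D : nat).
Implicit Types (f : 'rV[R]_D -> R) (N : 'I_D -> nat).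

Definition mle N N' : Prop := forall i, (N i <= N' i)%N.

Definition partial (i : 'I_D) f : 'rV[R]_D -> R :=
  fun x => 'D_(delta_mx 0 i : 'rV[R]_D) f x.

(* The head of [s] is the outermost (last) differentiation. *)
Definition iter_partial (s : seq 'I_D) f := foldr partial f s.

Definition mseq N : seq 'I_D := flatten [seq nseq (N i) i | i <- enum 'I_D].

Definition mderiv N f := iter_partial (mseq N) f.

(* All partial derivatives f^(j), j <= N, exist (in any order of
   differentiation) and are continuous on R^D. *)
Definition Cdiff N f : Prop :=
  forall s : seq 'I_D, (forall i, (count_mem i s <= N i)%N) ->
    continuous (iter_partial s f) /\
    (forall i, (count_mem i (i :: s) <= N i)%N ->
       forall x, derivable (iter_partial s f) x (delta_mx 0 i : 'rV[R]_D)).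

Definition sup_norm f : \bar R := ereal_sup [set (`|f x|)%:E | x in setT].

(* The sum over j <= N of the sup norms of the f^(j). *)
Definition Cnorm N f : \bar R :=
  (\sum_(j : {dffun forall i : 'I_D, 'I_(N i).+1})
     sup_norm (mderiv (fun i => j i) f))%E.

Definition Cbdiff N f : Prop := Cdiff N f /\ (Cnorm N f < +oo)%E.

Definition smooth_compact_support f : Prop :=
  (forall N, Cdiff N f) /\ compact (closure [set x | f x != 0]).

Definition chi N (x : 'rV[R]_D) : R :=
  \sum_(i < D) \sum_(0 <= k < (N i).+1) `|x 0 i| ^+ k.

End MultiIndices.

Section Measures.
Context (R : realType) (D : nat).
Notation E := 'rV[R]_D.
Implicit Types (mu nu : {measure set E -> \bar R}).

Definition Supp mu : set E :=
  [set x | forall U : set E, open U -> U x -> (0 < mu U)%E].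

(* The supremum is taken in [0, +oo] (it is 0 for the empty class).  With the
   conventions of \bar R, the distance is +oo as soon as some measurable f in H
   is not integrable for mu or for nu. *)
Definition dist (H : set (E -> R)) mu nu : \bar R :=
  ereal_sup ([set 0%E] `|`
    [set `| \int[mu]_x (f x)%:E - \int[nu]_x (f x)%:E |%E | f in H]).

Definition weak_cvg (I : Type) (F : set_system I)
    (mu : I -> {measure set E -> \bar R}) nu : Prop :=
  forall f : E -> R, continuous f -> (exists M : R, forall x, `|f x| <= M) ->
    (\int[mu i]_x (f x)%:E)%E @[i --> F] --> (\int[nu]_x (f x)%:E)%E.

End Measures.

Section KernelAction.
Context d d' (X : measurableType d) (Y : measurableType d') (R : realType).
Variables (nu : probability X R) (k : R.-pker X ~> Y).
Local Open Scope ereal_scope.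

(* the measure nu k : B |-> \int nu(dx) k(x, B) *)
Definition kact (B : set Y) : \bar R := \int[nu]_x k x B.

Let kact0 : kact set0 = 0.
Proof. by rewrite /kact integral0_eq// => x _; rewrite measure0. Qed.

Let kact_ge0 B : 0 <= kact B.
Proof. exact: integral_ge0. Qed.

Let kact_sigma_additive : semi_sigma_additive kact.
Proof.
move=> U mU tU mUU; rewrite [X in _ --> X](_ : _ =
  \int[nu]_x (\sum_(n <oo) k x (U n))); last first.
  apply: eq_integral => x _.
  by apply/esym/cvg_lim => //; exact/measure_semi_sigma_additive.
apply/cvg_closeP; split.
  by apply: is_cvg_nneseries => n _ _; exact: integral_ge0.
rewrite closeE// integral_nneseries// => n.
exact: measurable_kernel k _ (mU n).
Qed.

HB.instance Definition _ := isMeasure.Build _ _ R kact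
  kact0 kact_ge0 kact_sigma_additive.

Let kact_setT : kact setT = 1.
Proof.
rewrite /kact (eq_integral (cst 1)); last by move=> x _; rewrite prob_kernel.
by rewrite integral_cst// mul1e; exact: probability_setT.
Qed.

HB.instance Definition _ := Measure_isProbability.Build _ _ R kact kact_setT.

End KernelAction.

Section MarkovProcesses.
Context (R : realType) (D : nat).
Notation E := 'rV[R]_D.

(* The sigma-algebra generated by the variables Y i, i in J. *)
Definition sigma_gen (I Omega : Type) (J : set I) (Y : I -> Omega -> E) :
    set_system Omega :=
  <<s \bigcup_(i in J) preimage_set_system setT (Y i) measurable >>.

Definition cadlag (g : R -> E) : Prop :=
  forall t, 0 <= t -> g s @[s --> t^'+] --> g t /\
    (0 < t -> cvg (g s @[s --> t^'-])).

(* (X_t)_{t >= 0} is a homogeneous Markov process, PP x is its law when it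
   starts from x, and P t is its transition kernel.  The last clause says that
   Prob(X_{s+t} \in B | X_u, u <= s) = P_t(X_s, B) almost surely. *)
Definition markov_process d (Omega : measurableType d)
    (PP : E -> probability Omega R) (X : R -> Omega -> E)
    (P : R -> R.-pker E ~> E) : Prop :=
  [/\ forall t, 0 <= t -> measurable_fun setT (X t),
      forall x, {ae PP x, forall w, X 0 w = x},
      forall x, {ae PP x, forall w, cadlag (X ^~ w)},
      forall t x B, 0 <= t -> measurable B -> P t x B = PP x (X t @^-1` B)
    & forall x s t A B, 0 <= s -> 0 <= t ->
        sigma_gen [set u | 0 <= u <= s] X A -> measurable B ->
        PP x (A `&` X (s + t) @^-1` B) = (\int[PP x]_(w in A) P t (X s w) B)%E].

(* (y_n) is an inhomogeneous Markov chain and K n is its transition kernel from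
   time n to time n + 1. *)
Definition markov_chain d (Omega : measurableType d) (Pr : probability Omega R)
    (y : nat -> {RV Pr >-> E}) (K : nat -> R.-pker E ~> E) : Prop :=
  forall n A B,
    sigma_gen [set k : nat | (k <= n)%N] (fun k => y k : Omega -> E) A ->
    measurable B ->
    Pr (A `&` y n.+1 @^-1` B) = (\int[Pr]_(w in A) K n (y n w) B)%E.

End MarkovProcesses.

Section Semigroup.
Context (R : realType) (D : nat).
Notation E := 'rV[R]_D.
Variable P : R -> R.-pker E ~> E.

Definition sg (t : R) (f : E -> R) : E -> R := fun x => \int[P t x]_y f y.

Definition flow (nu : probability E R) (t : R) : probability E R :=
  kact nu (P t).

Definition bounded_measurable (f : E -> R) : Prop :=
  measurable_fun setT f /\ (sup_norm f < +oo)%E.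

Definition is_generator (f g : E -> R) : Prop :=
  [/\ bounded_measurable f, bounded_measurable g &
      sup_norm (fun x => t^-1 * (sg t f x - f x) - g x) @[t --> 0^'+] --> 0%E].

Definition dom : set (E -> R) := [set f | exists g, is_generator f g].

(* The generator, with the junk value 0 outside its domain. *)
Definition gen (f : E -> R) : E -> R :=
  xget (fun=> 0) [set g | is_generator f g].

Definition classF (N2 : 'I_D -> nat) : set (E -> R) :=
  [set f | [/\ dom f, Cbdiff N2 f, dom (gen f) &
    (sup_norm (gen f) + sup_norm (gen (gen f)) + Cnorm N2 f <= 1)%E]].

End Semigroup.

Section Chain.
Context (R : realType) (D : nat).
Notation E := 'rV[R]_D.
Implicit Types (gamma epsilon : nat -> R).

(* Sequences indexed by n >= 1: the value at 0 is irrelevant. *)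
Definition nonincreasing_to0 (u : nat -> R) : Prop :=
  (forall m n, (1 <= m <= n)%N -> u n <= u m) /\ u @ \oo --> (0 : R).

Definition step_sequence gamma : Prop :=
  [/\ forall n, (1 <= n)%N -> 0 < gamma n, nonincreasing_to0 gamma &
      (\sum_(1 <= k <oo) (gamma k)%:E = +oo)%E].

Definition tau gamma (n : nat) : R := \sum_(1 <= k < n.+1) gamma k.

(* The n such that tau_n <= t < tau_{n+1}, for t >= 0. *)
Definition step_index gamma (t : R) : nat :=
  xget 0%N [set n | tau gamma n <= t < tau gamma n.+1].

(* mu_t, the law of Y_t = y_n for tau_n <= t < tau_{n+1} *)
Definition interp_law gamma d (Omega : measurableType d)
    (Pr : probability Omega R) (y : nat -> {RV Pr >-> E}) (t : R) :
    probability E R :=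
  distribution Pr (y (step_index gamma t)).

(* Extended-real valued: finite for bounded f, and never -oo for f >= 0. *)
Definition chain_gen gamma (K : nat -> R.-pker E ~> E) (n : nat) (f : E -> R)
    (x : E) : \bar R :=
  (((gamma n.+1)^-1)%:E * \int[K n x]_z (f z - f x)%:E)%E.

Definition lambda gamma epsilon : \bar R :=
  (- limn_esup (fun n =>
       (ln (Num.max (gamma n) (epsilon n)) / tau gamma n)%:E))%E.

(* v l / (r + v + l), equal to v for l = +oo; the value at -oo is irrelevant. *)
Definition rate (r v : R) (l : \bar R) : \bar R :=
  match l with
  | (l')%:E => (v * l' / (r + v + l'))%:E
  | +oo%E => v%:E
  | -oo%E => -oo%E
  end.

End Chain.

(* Main.v *)
Require Import Defs.
From HB Require Import structures.
From mathcomp Require Import all_boot all_order all_algebra.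
From mathcomp Require Import all_classical all_reals all_analysis.
From mathcomp Require Import measurable_realfun giry.
From mathcomp Require Import ring lra.
Set Implicit Arguments.
Unset Strict Implicit.
Unset Printing Implicit Defensive.
Import Order.TTheory GRing.Theory Num.Theory.
Import numFieldNormedType.Exports.
Local Open Scope classical_set_scope.
Local Open Scope ring_scope.

(** The interpolated law [mu t] follows the semiflow [flow P] up to an error
    governed by the mesh [max (gamma n) (epsilon n)]; the three conclusions are
    three ways of exploiting this approximation.

    One step.  For a function [g] and a state [x] visited at time [n], both the
    mean of [g] after one step of the chain and the mean of [g] after time
    [h := gamma n.+1] of the limit semigroup are close to [g x + h * L g x],
    where [L] is the generator.  For the chain this is the convergence of the
    generators, whose weight [chi d1] has bounded mean along the chain
    ([chi_moments]: under the Lyapunov condition the mean of [V] obeys an affine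
    recursion).  For the semigroup it is a Taylor bound with remainder
    [h ^+ 2 * sup |L (L g)|] ([sg_taylor]).  That bound is obtained without any
    integral in time: [P_t f - f] is telescoped over [n] steps of length [t / n]
    and the very definition of the generator is applied to a single small step.
    Hence [one_step_error].

    Many steps.  For [f] in the class F, apply this to [g := P_(tau n - tau k) f]
    and telescope in [k].  The semigroup contracts the sup norm and commutes
    with its generator, so that [L (L g)] stays bounded by 1, and the regularity
    of the semigroup bounds the derivatives of [g] by [C T].  The sum over a time
    window of length [s] is at most a constant times [1 + T * (1 + C T)] times the
    mesh at the beginning of the window, [T] being slightly larger than [s]
    ([flow_approximation]).  When [lambda > l] the mesh at time [t] is
    [O (exp (- l t))] ([mesh_decay]).

    (i) Over a window of length [t > t0] the flow multiplies the distance to [pi]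
    by at most [exp (- u t)]; iterating over windows of equal length, the errors
    add up to a geometric series ([contraction_rate]).

    (ii) Use a single window, occupying the final fraction
    [l / (r + v + l)] of [[0, t]]: the growth [exp (r s)] of the approximation
    error, the decay [exp (- l (t - s))] of the mesh and the ergodic rate
    [exp (- v s)] then balance exactly ([uniform_ergodicity_rate]).

    (iii) The flow over a fixed long window brings all the laws [mu s] uniformly
    close to [pi] when tested against one bounded continuous function
    ([flow_uniform_cvg], by extracting a bad sequence), so [mu t] converges to
    [pi] when tested against the smooth compactly supported functions
    ([law_cvg]).  Since all the measures are probabilities, this is enough for
    weak convergence ([weak_cvg_of_smooth]): a continuous function with values
    in [[0, 1]] has smooth compactly supported minorants with almost the same
    integral for [pi].  These are built by layers from approximations of
    indicators of open sets, themselves made of bumps on rational cubes, and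
    smoothness comes from an algebra of functions that is stable under partial
    derivatives ([flat_algebra]). *)

(** * Integrals of bounded measurable functions *)

Section BoundedMeasurable.
Context d (T : measurableType d) (R : realType).
Implicit Types (mu : {measure set T -> \bar R}) (f g : T -> R) (M : R).

(** Carrying the bound [M] makes norm estimates and integrability one and the
    same hypothesis. *)
Definition mbounded M f := measurable_fun setT f /\ forall x, `|f x| <= M.

Lemma mbounded_cst c : mbounded `|c| (fun=> c : R).
Proof. by split=> // x. Qed.

Lemma mboundedB M M' f g : mbounded M f -> mbounded M' g ->
  mbounded (M + M') (fun x => f x - g x).
Proof.
move=> [mf fM] [mg gM]; split; first exact: measurable_funB.
by move=> x; rewrite (le_trans (ler_normB _ _))// lerD.
Qed.

Lemma mboundedD M M' f g : mbounded M f -> mbounded M' g ->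
  mbounded (M + M') (fun x => f x + g x).
Proof.
move=> [mf fM] [mg gM]; split; first exact: measurable_funD.
by move=> x; rewrite (le_trans (ler_normD _ _))// lerD.
Qed.

Lemma mboundedZ M f (c : R) : mbounded M f -> mbounded (`|c| * M) (fun x => c * f x).
Proof.
move=> [mf fM]; split; first exact: measurable_funM.
by move=> x; rewrite normrM ler_wpM2l.
Qed.

Variable mu : {measure set T -> \bar R}.
(* Not a [probability]: the values of a kernel are mere measures of mass 1. *)
Hypothesis mu1 : mu setT = 1%E.

Lemma mbounded_integrable M f : mbounded M f -> mu.-integrable setT (EFin \o f).
Proof.
move=> [mf fM]; apply: measurable_bounded_integrable => //.
  by rewrite mu1 ltry.
exists M; split; first exact: num_real.
by move=> M' MM' x _ /=; rewrite (le_trans (fM x))// ltW.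
Qed.

Lemma RintE M f : mbounded M f ->
  (\int[mu]_x (f x)%:E = (\int[mu]_x f x)%:E)%E.
Proof.
move=> bf; rewrite /Rintegral fineK//.
exact: (integrable_fin_num measurableT (mbounded_integrable bf)).
Qed.

Lemma Rint_cst (c : R) : \int[mu]_x c = c.
Proof. by rewrite Rintegral_cst// mu1 mulr1. Qed.

Lemma RintB M M' f g : mbounded M f -> mbounded M' g ->
  \int[mu]_x (f x - g x) = \int[mu]_x f x - \int[mu]_x g x.
Proof.
by move=> bf bg; rewrite RintegralB//; apply: mbounded_integrable; eassumption.
Qed.

Lemma RintD M M' f g : mbounded M f -> mbounded M' g ->
  \int[mu]_x (f x + g x) = \int[mu]_x f x + \int[mu]_x g x.
Proof.
by move=> bf bg; rewrite RintegralD//; apply: mbounded_integrable; eassumption.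
Qed.

Lemma RintZ M f (c : R) : mbounded M f -> \int[mu]_x (c * f x) = c * \int[mu]_x f x.
Proof. by move=> bf; rewrite RintegralZl//; apply: mbounded_integrable; eassumption. Qed.

Lemma ler_Rint M M' f g : mbounded M f -> mbounded M' g ->
  (forall x, f x <= g x) ->
  \int[mu]_x f x <= \int[mu]_x g x.
Proof.
by move=> bf bg fg; apply: le_Rintegral => //;
  apply: mbounded_integrable; eassumption.
Qed.

Lemma Rint_norm M f : mbounded M f -> `|\int[mu]_x f x| <= M.
Proof.
move=> bf; rewrite (le_trans (le_normr_Rintegral measurableT (mbounded_integrable bf)))//.
have babs : mbounded M (fun x => `|f x|).
  by case: bf => mf fM; split=> [|x]; [exact: measurableT_comp|rewrite normr_id].
have := @ler_Rint _ _ _ (fun=> M) babs (mbounded_cst M).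
by rewrite Rint_cst; apply=> x; exact: (bf.2 x).
Qed.

End BoundedMeasurable.

Lemma eq_Rint_measure d (T : measurableType d) (R : realType)
    (m1 m2 : {measure set T -> \bar R}) (f : T -> R) :
  (forall A, measurable A -> m1 A = m2 A) ->
  \int[m1]_x f x = \int[m2]_x f x.
Proof.
by move=> m12; rewrite /Rintegral (eq_measure_integral m2)// => A mA _; exact: m12.
Qed.

(** * Integration against kernels *)

Section KernelIntegral.
Context d d' (X : measurableType d) (Y : measurableType d') (R : realType).
Variables (nu : probability X R) (k : R.-pker X ~> Y).
Local Open Scope ereal_scope.

Let ksub (x : X) : set Y -> \bar R := k x.
HB.instance Definition _ x := Measure.on (ksub x).
HB.instance Definition _ x :=
  Measure_isSubProbability.Build _ _ _ (ksub x) (sprob_kernel_le1 k x).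
Let ksubP (x : X) : giry Y R := ksub x.

Let mksub : measurable_fun setT ksubP.
Proof.
apply: measurable_giry_codensity => // B mB.
exact: (measurable_kernel k B mB).
Qed.

(** [kact nu k] is the bind of the Giry monad, for which the formula is known;
    only the measurability of [k] as a map into measures is to be checked. *)
Lemma ge0_integral_kact (f : Y -> \bar R) : measurable_fun setT f ->
  (forall y, 0 <= f y) ->
  \int[kact nu k]_y f y = \int[nu]_x \int[k x]_y f y.
Proof.
move=> mf f0.
transitivity (giry_int (giry_bind nu mksub) f).
  apply: eq_measure_integral => A mA _.
  transitivity (\int[nu]_x (giry_ev (ksubP x) A)); first exact: eq_integral.
  by apply/esym/(@giry_int_map _ _ _ _ _ _ mksub nu (giry_ev^~ A)) => //;
    exact: measurable_giry_ev.
rewrite giry_int_bind//.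
Qed.

Lemma measurable_ge0_integral_ker (f : Y -> \bar R) : measurable_fun setT f ->
  (forall y, 0 <= f y) -> measurable_fun setT (fun x => \int[k x]_y f y).
Proof.
move=> mf f0; apply: measurable_fun_integral_kernel => // U mU.
exact: measurable_kernel.
Qed.

End KernelIntegral.

Section KernelAverage.
Context d d' (X : measurableType d) (Y : measurableType d') (R : realType).
Variables (k : R.-pker X ~> Y).

Definition kavg (f : Y -> R) (x : X) : R := \int[k x]_y f y.

(** Adding the bound [M] makes a function nonnegative, which transfers to bounded
    functions what is known of the integrals of nonnegative ones. *)
Let shift_avg M (f : Y -> R) x : mbounded M f ->
  (\int[k x]_y (f y + M)%:E = (kavg f x + M)%:E)%E.
Proof.
move=> bf; have k1 := prob_kernel (s := k) x.
have bM := @mbounded_cst _ Y R M.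
rewrite (RintE k1 (mboundedD bf bM)) (RintD k1 bf bM) Rint_cst//.
Qed.

Let shift_ge0 M (f : Y -> R) : mbounded M f -> forall y, (0 <= (f y + M)%:E)%E.
Proof. by move=> [_ fM] y; rewrite lee_fin -lerBlDr sub0r lerNnormlW. Qed.

Let shift_mfun M (f : Y -> R) : mbounded M f ->
  measurable_fun setT (fun y => (f y + M)%:E).
Proof. by move=> [mf _]; apply/measurable_EFinP; exact: measurable_funD. Qed.

Lemma mbounded_kavg M f : mbounded M f -> mbounded M (kavg f).
Proof.
move=> bf; split; last by move=> x; apply: Rint_norm bf; exact: prob_kernel.
have -> : kavg f = fun x => fine (\int[k x]_y (f y + M)%:E) - M.
  by apply/funext => x; rewrite (shift_avg _ bf)/= addrK.
apply: measurable_funB => //; apply: measurableT_comp => //.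
by apply: measurable_ge0_integral_ker; [exact: shift_mfun|exact: shift_ge0].
Qed.

Lemma Rint_kact (nu : probability X R) M f : mbounded M f ->
  \int[kact nu k]_y f y = \int[nu]_x kavg f x.
Proof.
move=> bf; have bM := @mbounded_cst _ Y R M; have bM' := @mbounded_cst _ X R M.
have p1 := probability_setT nu.
have q1 := probability_setT (kact nu k).
have := ge0_integral_kact nu k (shift_mfun bf) (shift_ge0 bf).
rewrite (RintE q1 (mboundedD bf bM)) (RintD q1 bf bM) Rint_cst//.
under eq_integral do rewrite (shift_avg _ bf).
rewrite (RintE p1 (mboundedD (mbounded_kavg bf) bM')).
rewrite (RintD p1 (mbounded_kavg bf) bM') Rint_cst//.
by move=> [] /addIr.
Qed.

Lemma kavgB M M' f g x : mbounded M f -> mbounded M' g ->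
  kavg (fun y => f y - g y) x = kavg f x - kavg g x.
Proof. by move=> bf bg; apply: RintB bf bg; exact: prob_kernel. Qed.

Lemma kavgZ M f (c : R) x : mbounded M f ->
  kavg (fun y => c * f y) x = c * kavg f x.
Proof. by move=> bf; apply: RintZ bf; exact: prob_kernel. Qed.

End KernelAverage.

Section BorelRow.
Context (R : realType) (D : nat).
Notation E := 'rV[R]_D.

Lemma open_measurable_row (U : set E) : open U -> measurable U.
Proof. by move=> oU; exact: sub_gen_smallest. Qed.

Lemma continuous_measurable_row (f : E -> R) : continuous f ->
  measurable_fun setT f.
Proof.
move=> cf; apply: (measurability (@RGenOpens.G R)).
  exact: RGenOpens.measurableE.
move=> _ [U [a [b ->]] <-]; rewrite setTI; apply: open_measurable_row.
by apply: open_comp => // x _; exact: cf.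
Qed.

End BorelRow.

(** * The semigroup and its generator *)

(** Convergence to 0 in the extended reals, without passing to finite parts. *)
Lemma ge0_cvge0P (R : realType) (T : Type) (F : set_system T)
    (FF : Filter F) (f : T -> \bar R) : (forall t, 0 <= f t)%E ->
  f t @[t --> F] --> 0%E <->
  forall e, 0 < e -> \forall t \near F, (f t <= e%:E)%E.
Proof.
move=> f0; split=> [h e e0|h].
  apply: (h [set z | (z <= e%:E)%E]); exists e => //= x.
  by rewrite /ball_/= sub0r normrN lee_fin => xe; rewrite ltW// (le_lt_trans (ler_norm _)).
move=> A [d /= d0 dA]; have d20 : 0 < d / 2 by rewrite divr_gt0.
apply: filterS (h _ d20) => t /=; have := f0 t.
case: (f t) => [r| |]//=; rewrite !lee_fin => r0 rd; apply: dA => /=.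
by rewrite sub0r normrN ger0_norm// (le_lt_trans rd)// ltr_pdivrMr// ltr_pMr// ltr1n.
Qed.

Section SupNorm.
Context (R : realType) (D : nat).
Notation E := 'rV[R]_D.
Implicit Types f : E -> R.

Lemma sup_norm_ub f x : (`|f x|%:E <= sup_norm f)%E.
Proof. by apply: ereal_sup_ubound; exists x. Qed.

Lemma sup_norm_ge0 f : (0 <= sup_norm f)%E.
Proof. by apply: le_trans (sup_norm_ub f 0); rewrite lee_fin. Qed.

Lemma sup_norm_leP f (M : R) :
  (sup_norm f <= M%:E)%E <-> forall x, `|f x| <= M.
Proof.
split=> [h x|h]; first by rewrite -lee_fin; exact: le_trans (sup_norm_ub f x) h.
by apply: ge_ereal_sup => _ [x _ <-]; rewrite lee_fin.
Qed.

Lemma bounded_measurableP f : bounded_measurable f <-> exists M, mbounded M f.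
Proof.
split=> [[mf fb]|[M [mf fM]]]; last first.
  by split=> //; apply: le_lt_trans (ltry M); exact/sup_norm_leP.
exists (fine (sup_norm f)); split=> //; apply/sup_norm_leP.
by rewrite fineK// ge0_fin_numE// sup_norm_ge0.
Qed.

End SupNorm.

Section MarkovSemigroup.
Context (R : realType) (D : nat).
Notation E := 'rV[R]_D.
Variable P : R -> R.-pker E ~> E.

Definition chapman_kolmogorov :=
  (forall x B, measurable B -> P 0 x B = \d_x B) /\
  (forall s t x B, 0 <= s -> 0 <= t -> measurable B ->
     P (s + t) x B = (\int[P s x]_z P t z B)%E).

(** [X 0 = x] almost surely gives the first identity, and the Markov property for
    the trivial event of the past the second. *)
Lemma markov_process_chapman_kolmogorov dX (OmegaX : measurableType dX)
    (PP : E -> probability OmegaX R) (X : R -> OmegaX -> E) :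
  markov_process PP X P -> chapman_kolmogorov.
Proof.
move=> [mX X0 _ PE PM]; split=> [x B mB|s t x B s0 t0 mB].
  rewrite PE//.
  have mXB : measurable (X 0 @^-1` B) by rewrite -[_ @^-1` _]setTI; exact: mX.
  have {}X0 : {ae PP x, forall w, X 0 w = x} := X0 x.
  rewrite diracE; have [xB|xB] := boolP (x \in B).
    rewrite -(probability_setT (PP x)).
    apply/eqP; rewrite eq_le le_measure ?inE//=.
    have [N [mN N0 sN]] := X0.
    rewrite -[leRHS]adde0 -N0.
    apply: le_trans (measureU2 _ mXB mN).
    apply: le_measure; rewrite ?inE//; first exact: measurableU.
    move=> w _; have [wx|/sN] := pselect (X 0 w = x); last by right.
    by left; rewrite /preimage/= wx; apply/set_mem.
  have [N [mN N0 sN]] := X0.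
  apply/eqP; rewrite eq_le measure_ge0 andbT [leRHS](_ : _ = PP x N)//.
  apply: le_measure; rewrite ?inE// => w /= wB; apply: sN => /= wx.
  by move: xB; rewrite -wx => /negP; apply; apply/mem_set.
rewrite PE ?addr_ge0//.
have := PM x s t setT B s0 t0; rewrite setTI => -> //; last first.
  by rewrite -setC0; apply: sigma_algebraC; exact: sigma_algebra0.
transitivity (\int[pushforward (PP x) (X s)]_z P t z B)%E.
  rewrite ge0_integral_pushforward//; [exact: mX|exact: measurable_kernel].
apply: eq_measure_integral; first exact: mX.
by move=> ms A mA _; rewrite PE.
Qed.

Hypothesis CK : chapman_kolmogorov.

Lemma sg0 M f : mbounded M f -> sg P 0 f = f.
Proof.
move=> [mf _]; apply/funext => x; rewrite /sg.
rewrite (@eq_Rint_measure _ _ _ _ (\d_x)); last by move=> A mA; rewrite CK.1.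
by rewrite /Rintegral integral_dirac ?diracT ?mul1e//; exact/measurable_EFinP.
Qed.

Let kset t x : set E -> \bar R := P t x.
HB.instance Definition _ t x := Measure.on (kset t x).
HB.instance Definition _ t x :=
  Measure_isProbability.Build _ _ _ (kset t x) (prob_kernel (s := P t) x).

Lemma sg_comp M f s t : mbounded M f -> 0 <= s -> 0 <= t ->
  sg P (s + t) f = sg P s (sg P t f).
Proof.
move=> bf s0 t0; apply/funext => x; rewrite {1}/sg.
transitivity (\int[kact (kset s x) (P t)]_y f y).
  by apply: eq_Rint_measure => A mA; rewrite CK.2.
by rewrite (Rint_kact _ _ bf).
Qed.

Lemma mbounded_sg M f t : mbounded M f -> mbounded M (sg P t f).
Proof. exact: mbounded_kavg. Qed.

Lemma sgB M M' f g t x : mbounded M f -> mbounded M' g ->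
  sg P t (fun y => f y - g y) x = sg P t f x - sg P t g x.
Proof. exact: kavgB. Qed.

Lemma sgZ M f c t x : mbounded M f ->
  sg P t (fun y => c * f y) x = c * sg P t f x.
Proof. exact: kavgZ. Qed.

Lemma is_generatorP f g : is_generator P f g <->
  [/\ exists M, mbounded M f, exists M, mbounded M g &
    forall e, 0 < e -> exists2 d, 0 < d & forall t, 0 < t < d ->
      forall x, `|t^-1 * (sg P t f x - f x) - g x| <= e].
Proof.
split=> [[/bounded_measurableP bf /bounded_measurableP bg lim]|
         [bf bg h]]; split=> //; try exact/bounded_measurableP.
  move=> e e0.
  have := (ge0_cvge0P _ (fun=> sup_norm_ge0 _)).1 lim e e0.
  move=> [d /= d0 dP].
  exists d => // t /andP[t0 td]; apply/sup_norm_leP; apply: dP => //=.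
  by rewrite sub0r normrN gtr0_norm.
apply/(ge0_cvge0P _ (fun=> sup_norm_ge0 _)) => e /h[d d0 dP].
exists d => // t /=; rewrite sub0r normrN => td t0; apply/sup_norm_leP => x.
by apply: dP; rewrite t0 -(gtr0_norm t0).
Qed.

Lemma is_generator_unique f g g' : is_generator P f g -> is_generator P f g' ->
  g = g'.
Proof.
move=> /is_generatorP[_ _ h] /is_generatorP[_ _ h']; apply/funext => x.
apply/eqP; rewrite -subr_eq0 -normr_le0; apply/ler_addgt0Pl => e e0.
have e20 : 0 < e / 2 by rewrite divr_gt0.
have [d d0 dP] := h _ e20; have [d' d'0 d'P] := h' _ e20.
pose m := Num.min d d'; have m0 : 0 < m by rewrite lt_min d0.
have m2 : m / 2 < m by rewrite ltr_pdivrMr// ltr_pMr// ltr1n.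
have /andP[md md'] : (m / 2 < d) && (m / 2 < d') by rewrite -lt_min.
have m20 : 0 < m / 2 by rewrite divr_gt0.
have := d'P (m / 2) _ x; rewrite m20 md' => /(_ isT).
have := dP (m / 2) _ x; rewrite m20 md => /(_ isT).
rewrite addr0.
set A := _ * _ => h1 h2; have -> : g x - g' x = (A - g' x) - (A - g x) by ring.
by rewrite (le_trans (ler_normB _ _))// (splitr e) lerD.
Qed.

Lemma genE f g : is_generator P f g -> gen P f = g.
Proof.
move=> fg; apply: is_generator_unique (fg).
by rewrite /gen; case: xgetP => [g' _ //|/(_ g)/(_ fg)].
Qed.

Lemma dom_gen f : dom P f -> is_generator P f (gen P f).
Proof. by move=> [g fg]; rewrite (genE fg). Qed.

Lemma mbounded_sg_sub M f t : mbounded M f ->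
  mbounded (M + M) (fun x => sg P t f x - f x).
Proof. by move=> bf; apply: mboundedB => //; exact: mbounded_sg. Qed.

(** [P_t] contracts the sup norm and commutes with [P_s], so it can be applied to
    the difference quotients that define [g]. *)
Lemma is_generator_sg f g t : 0 <= t -> is_generator P f g ->
  is_generator P (sg P t f) (sg P t g).
Proof.
move=> t0 /is_generatorP[[M bf] [M' bg] h]; apply/is_generatorP; split.
- by exists M; exact: mbounded_sg.
- by exists M'; exact: mbounded_sg.
move=> e e0; have [d d0 dP] := h e e0; exists d => // s sd x.
have s0 : 0 <= s by case/andP: sd => /ltW.
have bs := mboundedZ s^-1 (mbounded_sg_sub s bf).
rewrite -(sg_comp bf)// (addrC s t) (sg_comp bf)//.
rewrite -(sgB _ _ (mbounded_sg s bf) bf).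
rewrite -(sgZ s^-1 _ _ (mbounded_sg_sub s bf)) -(sgB _ _ bs bg).
apply: Rint_norm; first exact: prob_kernel.
by split=> [|z]; [exact: (mboundedB bs bg).1|exact: dP].
Qed.

Lemma small_div (t d : R) : 0 < t -> 0 < d -> exists n : nat, 0 < t / n.+1%:R < d.
Proof.
move=> t0 d0; have /archi_boundP := ltW (divr_gt0 t0 d0).
set n := Num.bound _ => nP; exists n; rewrite divr_gt0//=.
rewrite ltr_pdivrMr// mulrC -ltr_pdivrMr//.
by rewrite (lt_trans nP)// ltr_nat.
Qed.

(** The bound holds up to [e] for small times, by definition of the generator; it
    extends to all times because [P_t f - f] is a sum of [n] increments
    [P_(k s) (P_s f - f)], [s := t / n], each as small as the first. *)
Lemma sg_lipschitz f g G t x : is_generator P f g -> (forall x, `|g x| <= G) ->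
  0 <= t -> `|sg P t f x - f x| <= t * G.
Proof.
move=> /is_generatorP[[M bf] _ h] gG; rewrite le_eqVlt => /predU1P[<-|t0].
  by rewrite (sg0 bf) subrr normr0 mul0r.
apply/ler_addgt0Pl => e e0; have et : 0 < e / t by rewrite divr_gt0.
have [d d0 dP] := h _ et; have [n /dP{}dP] := small_div t0 d0.
pose s := t / n.+1%:R; have s0 : 0 < s by rewrite divr_gt0.
(* e / t, so that the t / s errors of size s * (e / t) add up to e *)
have step z : `|sg P s f z - f z| <= s * (G + e / t).
  rewrite -ler_pdivrMl// -{1}(gtr0_norm s0) -normfV -normrM.
  have -> : s^-1 * (sg P s f z - f z) =
    g z + (s^-1 * (sg P s f z - f z) - g z) by ring.
  by rewrite (le_trans (ler_normD _ _))// lerD//; exact: dP.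
have ind k : `|sg P (k%:R * s) f x - f x| <= k%:R * s * (G + e / t).
  elim: k => [|k ih]; first by rewrite !mul0r (sg0 bf) subrr normr0.
  rewrite -natr1 mulrDl mul1r (sg_comp bf) ?(ltW s0)//; last by rewrite mulr_ge0 ?(ltW s0).
  have -> : sg P (k%:R * s) (sg P s f) x - f x =
    sg P (k%:R * s) (fun z => sg P s f z - f z) x + (sg P (k%:R * s) f x - f x).
    by rewrite (sgB _ _ (mbounded_sg s bf) bf); ring.
  rewrite mulrDl (le_trans (ler_normD _ _))// [leRHS]addrC lerD//.
  apply: Rint_norm; first exact: prob_kernel.
  by split; [exact: (mbounded_sg_sub s bf).1|exact: step].
have := ind n.+1; rewrite {1 2}/s mulrC divfK// => /le_trans; apply.
by rewrite mulrDr (mulrC e) mulVKf ?gt_eqF// addrC.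
Qed.

(** Same telescoping.  In [P_(k s) (P_s f - f)] the main term is
    [s * P_(k s) g], and [P_(k s) g] differs from [g] by at most [k s G] by
    [sg_lipschitz]; summing over [k] gives [t ^+ 2 * G]. *)
Lemma sg_taylor f g g2 G x t : is_generator P f g -> is_generator P g g2 ->
  (forall x, `|g2 x| <= G) -> 0 <= t ->
  `|sg P t f x - f x - t * g x| <= t ^+ 2 * G.
Proof.
move=> fg gg2 g2G; have [[M bf] [M' bg] h] := (is_generatorP _ _).1 fg.
rewrite le_eqVlt => /predU1P[<-|t0].
  by rewrite (sg0 bf) subrr sub0r mul0r normrN normr0 expr0n mul0r.
have G0 : 0 <= G by exact: le_trans (normr_ge0 (g2 0)) _.
apply/ler_addgt0Pl => e e0; have et : 0 < e / t by rewrite divr_gt0.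
have [d d0 dP] := h _ et; have [n /dP{}dP] := small_div t0 d0.
pose s := t / n.+1%:R; have s0 : 0 < s by rewrite divr_gt0.
have step z : `|sg P s f z - f z - s * g z| <= s * (e / t).
  rewrite -ler_pdivrMl// -{1}(gtr0_norm s0) -normfV -normrM mulrBr mulKf ?gt_eqF//.
have bsg := mboundedZ s bg.
have ind k : `|sg P (k%:R * s) f x - f x - k%:R * s * g x|
    <= k%:R * s * (e / t) + (k%:R * s) ^+ 2 * G.
  elim: k => [|k ih].
    by rewrite !mul0r (sg0 bf) subrr sub0r normrN normr0 expr0n mul0r addr0.
  have ks0 : 0 <= k%:R * s by rewrite mulr_ge0// ltW.
  rewrite -natr1 mulrDl mul1r (sg_comp bf) ?(ltW s0)//.
  have -> : sg P (k%:R * s) (sg P s f) x - f x - (k%:R * s + s) * g x =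
    sg P (k%:R * s) (fun z => sg P s f z - f z - s * g z) x +
    s * (sg P (k%:R * s) g x - g x) +
    (sg P (k%:R * s) f x - f x - k%:R * s * g x).
    rewrite (sgB _ _ (mbounded_sg_sub s bf) bsg) (sgB _ _ (mbounded_sg s bf) bf).
    by rewrite (sgZ _ _ _ bg); ring.
  have h1 : `|sg P (k%:R * s) (fun z => sg P s f z - f z - s * g z) x| <= s * (e / t).
    apply: Rint_norm; first exact: prob_kernel.
    by split; [exact: (mboundedB (mbounded_sg_sub s bf) bsg).1|exact: step].
  have h2 : `|s * (sg P (k%:R * s) g x - g x)| <= s * (k%:R * s * G).
    by rewrite normrM gtr0_norm// ler_pM2l//; exact: (sg_lipschitz x gg2 g2G).
  rewrite (le_trans (ler_normD _ _))//.
  (* (a + s)^2 absorbs a^2 + s * a, with a slack of s * (a + s) *)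
  apply: le_trans (lerD (le_trans (ler_normD _ _) (lerD h1 h2)) ih) _.
  set a := k%:R * s in ks0 *; rewrite -subr_ge0.
  have -> : (a + s) * (e / t) + (a + s) ^+ 2 * G - (s * (e / t) + s * (a * G) +
    (a * (e / t) + a ^+ 2 * G)) = s * (a + s) * G by ring.
  by rewrite !mulr_ge0 ?addr_ge0// ltW.
have := ind n.+1; have -> : n.+1%:R * s = t by rewrite mulrC divfK.
by rewrite (mulrC t (e / t)) divfK ?gt_eqF.
Qed.

End MarkovSemigroup.

(** * Rational cubes and supports *)

Section RationalCubes.
Context (R : realType) (D : nat).
Notation E := 'rV[R]_D.

Lemma coordinate_continuous (i : 'I_D) : continuous (fun x : E => x 0 i).
Proof. exact: coord_continuous. Qed.

Definition cube (q : 'rV[rat]_D) (e : rat) : set E :=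
  [set x | forall i, `|x 0 i - ratr (q 0 i)| < ratr e].

Lemma measurable_cube q e : measurable (cube q e).
Proof.
have -> : cube q e =
    \bigcap_(i in [set: 'I_D]) [set x : E | `|x 0 i - ratr (q 0 i)| < ratr e].
  by apply/seteqP; split=> x /= h i; [move=> _|]; apply: h.
apply: fin_bigcap_measurable => // i _; apply: open_measurable_row.
apply: (@open_comp _ _ (fun x : E => `|x 0 i - ratr (q 0 i)|) [set z | z < ratr e]).
  move=> x _.
  have xi : (z : E) 0 i @[z --> x] --> x 0 i by exact: coordinate_continuous.
  exact: (cvg_norm (cvgB xi (cvg_cst _))).
exact: open_lt.
Qed.

Lemma open_rational_cube (U : set E) x : open U -> U x ->
  exists q e, cube q e x /\ cube q e `<=` U.
Proof.
move=> oU Ux; have /nbhs_ballP[d /= d0 dU] : nbhs x U by exact: open_nbhs_nbhs.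
have /rat_in_itvoo[e] : 0 < d / 2 by rewrite divr_gt0.
rewrite in_itv/= => /andP[e0 ed].
have hq i : exists r : rat, `|x 0 i - ratr r| < ratr e.
  have /rat_in_itvoo[r] : x 0 i - ratr e < x 0 i + ratr e by lra.
  rewrite in_itv/= => /andP[r1 r2]; exists r.
  by rewrite ltr_norml; apply/andP; split; lra.
have [q qP] := choice hq.
exists (\row_i q i), e; split=> [i|y yc]; first by rewrite mxE.
apply: dU; split => // i j; rewrite (ord1 i) /ball/=.
have := yc j; rewrite mxE => yj.
have -> : x 0 j - y 0 j = (x 0 j - ratr (q j)) - (y 0 j - ratr (q j)) by ring.
rewrite (le_lt_trans (ler_normB _ _))// (lt_trans (ltrD (qP j) yj))//.
by rewrite (splitr d) ltrD.
Qed.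

(** The complement of the support is covered by the rational cubes of measure 0,
    and these are countably many. *)
Lemma negligible_not_Supp (nu : probability E R) : nu.-negligible (~` Supp nu).
Proof.
pose F n := if @unpickle ('rV[rat]_D * rat)%type n is Some (q, e) then
  if nu (cube q e) == 0%E then cube q e else set0 else set0.
apply: (@negligibleS _ _ _ _ (\bigcup_n F n)); last first.
  apply: negligible_bigcup => n; rewrite /F.
  case: unpickle => [[q e]|]; last exact: negligible_set0.
  case: ifPn => [/eqP q0|_]; last exact: negligible_set0.
  by exists (cube q e); split => //; exact: measurable_cube.
move=> x /= /existsNP[U /not_implyP[oU /not_implyP[Ux /negP]]].
rewrite -leNgt => U0.
have [q [e [xqe qeU]]] := open_rational_cube oU Ux.
exists (pickle (q, e)) => //; rewrite /F pickleK ifT//.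
rewrite eq_le measure_ge0 andbT (le_trans _ U0)//.
by apply: le_measure; rewrite ?inE//; [exact: measurable_cube|exact: open_measurable_row].
Qed.

End RationalCubes.

(** * Polynomial weights and the laws of the chain *)

Section Chi.
Context (R : realType) (D : nat).
Notation E := 'rV[R]_D.

Lemma chi_ge0 N (x : E) : 0 <= chi N x.
Proof. by rewrite /chi; apply: sumr_ge0 => i _; apply: sumr_ge0. Qed.

Lemma chi_le N N' (x : E) : mle N N' -> chi N x <= chi N' x.
Proof.
move=> NN; apply: ler_sum => i _.
rewrite (@big_cat_nat _ _ _ (N i).+1 0%N (N' i).+1)//=; last by rewrite ltnS; exact: NN.
by rewrite lerDl; apply: sumr_ge0 => k _.
Qed.

Lemma measurable_chi N : measurable_fun setT (chi N : E -> R).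
Proof.
apply: measurable_sum => i; apply: measurable_sum => k.
apply: measurable_funX; apply: measurableT_comp => //.
by apply: continuous_measurable_row; exact: coordinate_continuous.
Qed.

Lemma coord_le_norm (x : E) i : `|x 0 i| <= `|x|.
Proof.
rewrite [leRHS]mx_normrE.
exact: (le_bigmax _ (fun ij : 'I_1 * 'I_D => `|x ij.1 ij.2|) (0, i)).
Qed.

Lemma chi_le_ball N a (x : E) : `|x| <= a ->
  chi N x <= \sum_(i < D) \sum_(0 <= k < (N i).+1) a ^+ k.
Proof.
move=> xa; apply: ler_sum => i _; apply: ler_sum => k _.
apply: lerXn2r; rewrite ?nnegrE//; last exact: le_trans (coord_le_norm _ _) xa.
exact: le_trans xa.
Qed.

End Chi.

Section OneStep.
Context (R : realType) (D : nat).
Notation E := 'rV[R]_D.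
Context (dy : measure_display) (Omega : measurableType dy)
  (Pr : probability Omega R) (y : nat -> {RV Pr >-> E}).

Lemma expectation_law n (f : E -> R) : measurable_fun setT f ->
  ('E_Pr[f \o y n] = \int[distribution Pr (y n)]_x (f x)%:E)%E.
Proof.
move=> mf; have mF : measurable_fun setT (EFin \o f) by exact/measurable_EFinP.
rewrite unlock integralE [RHS]integralE.
rewrite (ge0_integral_distribution (y n) (measurable_funepos mF) (funepos_ge0 _)).
rewrite (ge0_integral_distribution (y n) (measurable_funeneg mF) (funeneg_ge0 _)).
by congr (_ - _)%E; apply: eq_integral => w _; rewrite /= ?funeposE ?funenegE.
Qed.

Variable K : nat -> R.-pker E ~> E.
Hypothesis hy : markov_chain y K.

(** The Markov property for the trivial event of the past. *)
Lemma law_step n A : measurable A ->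
  distribution Pr (y n.+1) A = kact (distribution Pr (y n)) (K n) A.
Proof.
move=> mA; transitivity (\int[Pr]_w K n (y n w) A)%E.
  have := @hy n setT A; rewrite setTI; apply => //.
  by rewrite -setC0; apply: sigma_algebraC; exact: sigma_algebra0.
by rewrite /kact ge0_integral_distribution//; exact: measurable_kernel.
Qed.

Lemma integral_law_step n (f : E -> \bar R) : measurable_fun setT f ->
  (forall x, 0 <= f x)%E ->
  (\int[distribution Pr (y n.+1)]_x f x =
   \int[distribution Pr (y n)]_x \int[K n x]_z f z)%E.
Proof.
move=> mf f0; rewrite -ge0_integral_kact//.
by apply: eq_measure_integral => A mA _; exact: law_step.
Qed.

Lemma Rint_law_step n M f : mbounded M f ->
  \int[distribution Pr (y n.+1)]_x f x =
  \int[distribution Pr (y n)]_x kavg (K n) f x.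
Proof.
move=> bf; rewrite -(Rint_kact _ _ bf).
by apply: eq_Rint_measure => A mA; exact: law_step.
Qed.

Variable gamma : nat -> R.

(** The negative part of [V - V x] is at most [V x], so that the upper bound
    forces the integral of [V] for the kernel to be finite. *)
Lemma integral_chain_gen_le n (V : E -> R) x r : 0 < gamma n.+1 ->
  measurable_fun setT V -> (forall z, 0 <= V z) ->
  (chain_gen gamma K n V x <= r%:E)%E ->
  (\int[K n x]_z (V z)%:E <= (V x + gamma n.+1 * r)%:E)%E.
Proof.
move=> g0 mV V0; rewrite /chain_gen lee_pdivrMl//; set c := V x => h.
have mVc : measurable_fun setT (fun z => V z - c) by exact: measurable_funB.
have mVe : measurable_fun setT (fun z => (V z - c)%:E) by exact/measurable_EFinP.
have K1 := prob_kernel (s := K n) x.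
move: h; rewrite integralE; set f := fun z => _.
set Ip := integral _ _ (funepos _); set Im := integral _ _ (funeneg _) => h.
(* V + (V - c)^- = (V - c)^+ + c involves nonnegative functions only *)
have key : (\int[K n x]_z (V z)%:E + Im = Ip + c%:E)%E.
  rewrite -[c%:E]mule1 -K1 -integral_cst//.
  rewrite -ge0_integralD//; first last.
  - exact: measurable_funeneg.
  - exact/measurable_EFinP.
  - by move=> z _; rewrite lee_fin.
  rewrite -ge0_integralD//; first last.
  - by move=> z _; rewrite lee_fin /c.
  - exact: measurable_funepos.
  apply: eq_integral => z _; rewrite /f funeposE funenegE.
  rewrite -EFinN -!EFin_max -!EFinD; congr EFin.
  have [Vc|Vc] := leP (V z - c) 0; first by rewrite max_l ?oppr_ge0//; ring.
  by rewrite max_r ?oppr_le0 ?ltW//; ring.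
have Im0 : (0 <= Im)%E by exact: integral_ge0.
have Imc : (Im <= c%:E)%E.
  rewrite -[c%:E]mule1 -K1 -integral_cst//; apply: ge0_le_integral => //.
  - exact: measurable_funeneg.
  - by move=> z _ /=; rewrite /f funenegE -EFinN -EFin_max lee_fin ge_max
      opprB gerBl !V0.
have Imf : Im \is a fin_num.
  by rewrite ge0_fin_numE// (le_lt_trans Imc)// ltry.
clearbody Ip Im.
rewrite -(leeD2rE _ _ Imf) key EFinD -addeA (addeC Ip) leeD2l//.
by rewrite -leeBlDr.
Qed.

End OneStep.

(** * Steps and times *)

Section StepSequence.
Context (R : realType) (gamma : nat -> R).
Hypothesis hgamma : step_sequence gamma.

Lemma step_gt0 n : (1 <= n)%N -> 0 < gamma n.
Proof. by case: hgamma => + _ _; apply. Qed.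

Lemma nonincreasing_to0_ge0 (u : nat -> R) n : nonincreasing_to0 u -> (1 <= n)%N ->
  0 <= u n.
Proof.
move=> [dec lim] n1; rewrite -(cvg_lim (@Rhausdorff R) lim).
apply: limr_le; first by apply/cvg_ex; exists 0.
by exists n => // k /= nk; apply: dec; rewrite n1.
Qed.

Lemma tauS n : tau gamma n.+1 = tau gamma n + gamma n.+1.
Proof. by rewrite /tau big_nat_recr. Qed.

Lemma tau0 : tau gamma 0 = 0.
Proof. by rewrite /tau big_geq. Qed.

Lemma tau_le m n : (m <= n)%N -> tau gamma m <= tau gamma n.
Proof.
move=> /subnK <-; elim: (n - m)%N => // k ih.
by rewrite addSn tauS (le_trans ih)// lerDl ltW// step_gt0.
Qed.

Lemma tau_ge0 n : 0 <= tau gamma n.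
Proof. by rewrite -tau0 tau_le. Qed.

Lemma tau_unbounded (t : R) : exists n, t < tau gamma n.
Proof.
apply: contrapT => /forallNP h.
have : (\sum_(1 <= k <oo) (gamma k)%:E <= t%:E)%E.
  apply: lime_le; first by apply: is_cvg_nneseries => k k1 _; rewrite lee_fin ltW// step_gt0.
  apply: nearW => n; rewrite sumEFin lee_fin.
  have /negP := h n.-1; rewrite -leNgt /tau; case: n => [|n]//.
by case: hgamma => _ _ ->.
Qed.

Lemma step_indexP (t : R) : 0 <= t ->
  tau gamma (step_index gamma t) <= t < tau gamma (step_index gamma t).+1.
Proof.
move=> t0; rewrite /step_index; case: xgetP => [n _ //|h]; exfalso.
have [n] := tau_unbounded t.
elim: n => [|n ih]; first by rewrite tau0 ltNge t0.
have [/ih//|nt tn] := ltP t (tau gamma n).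
by apply: (h n); rewrite /= nt tn.
Qed.

Lemma step_index_le (s t : R) : 0 <= s -> s <= t ->
  (step_index gamma s <= step_index gamma t)%N.
Proof.
move=> s0 st; rewrite leqNgt; apply/negP => ts.
have /andP[_ h1] := step_indexP (le_trans s0 st).
have /andP[h2 _] := step_indexP s0.
have := le_lt_trans (le_trans (tau_le ts) (le_trans h2 st)) h1.
by rewrite ltxx.
Qed.

Lemma step_index_ge n (t : R) : tau gamma n <= t -> (n <= step_index gamma t)%N.
Proof.
move=> nt; have t0 := le_trans (tau_ge0 n) nt.
rewrite -ltnS ltnNge; apply/negP => /tau_le tn.
have /andP[_ h1] := step_indexP t0.
by have := lt_le_trans h1 (le_trans tn nt); rewrite ltxx.
Qed.

End StepSequence.

(** * Sup norms of derivatives *)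

Section ClassF.
Context (R : realType) (D : nat).
Notation E := 'rV[R]_D.

Lemma sup_norm_le_Cnorm N (f : E -> R) : (sup_norm f <= Cnorm N f)%E.
Proof.
pose j0 : {dffun forall i : 'I_D, 'I_(N i).+1} := finfun (fun i => ord0).
rewrite /Cnorm (bigD1 j0)//=.
have -> : mderiv (fun i => j0 i) f = f.
  rewrite /mderiv (_ : mseq _ = [::])// /mseq.
  by elim: (enum 'I_D) => //= i s ->; rewrite ffunE.
by rewrite leeDl// sume_ge0// => *; exact: sup_norm_ge0.
Qed.

Lemma Cnorm_ge0 N (f : E -> R) : (0 <= Cnorm N f)%E.
Proof. exact: le_trans (sup_norm_ge0 f) (sup_norm_le_Cnorm N f). Qed.

Lemma Cnorm_le N (f : E -> R) (c : R) :
  (forall j, mle j N -> forall x, `|mderiv j f x| <= c) ->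
  (Cnorm N f <= (#|{dffun forall i : 'I_D, 'I_(N i).+1}|%:R * c)%:E)%E.
Proof.
move=> h; rewrite mulr_natl -sum1_card -sumrMnr -sumEFin.
apply: lee_sum => j _; apply/sup_norm_leP => x.
by rewrite mulr1n; apply: h => i; rewrite -ltnS.
Qed.

End ClassF.

(** * Moments of the chain *)

Section Moments.
Context (R : realType) (D : nat).
Notation E := 'rV[R]_D.
Context (dy : measure_display) (Omega : measurableType dy)
  (Pr : probability Omega R) (y : nat -> {RV Pr >-> E})
  (K : nat -> R.-pker E ~> E) (hy : markov_chain y K)
  (gamma : nat -> R) (hgamma : step_sequence gamma).
Local Notation law n := (distribution Pr (y n)).

Let lawT n : (law n : {measure set E -> \bar R}) setT = 1%E.
Proof. exact: probability_setT. Qed.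

(** Once [alpha * gamma n.+1 <= 1], the right-hand side is a convex combination of
    [e n] and [beta / alpha], so it cannot exceed their maximum. *)
Lemma affine_recursion_bounded (e : nat -> R) (n0 : nat) (alpha beta : R) :
  0 < alpha -> 0 <= beta -> (forall n, 0 <= e n) ->
  (forall n, (n0 <= n)%N -> alpha * gamma n.+1 <= 1 ->
     e n.+1 <= (1 - alpha * gamma n.+1) * e n + gamma n.+1 * beta) ->
  exists B, forall n, e n <= B.
Proof.
move=> a0 b0 e0 rec; have [_ [_ lim] _] := hgamma.
have : \forall n \near \oo, gamma n < alpha^-1.
  by apply: (cvgr_lt 0) => //; rewrite invr_gt0.
move=> [n1 _ n1P]; pose n2 := maxn n0 n1.
have gP n : (n2 <= n)%N -> alpha * gamma n.+1 <= 1.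
  move=> n2n; rewrite -ler_pdivlMl// mulr1 ltW//; apply: n1P => /=.
  by rewrite (leq_trans (leq_maxr n0 n1))// (leq_trans n2n).
pose B := beta / alpha + \sum_(0 <= k < n2.+1) e k; exists B => n.
have BS k : (k <= n2)%N -> e k <= B.
  move=> kn; rewrite /B (big_rem k)/= ?mem_index_iota ?ltnS//.
  by rewrite addrCA lerDl addr_ge0// ?divr_ge0 ?sumr_ge0// ltW.
have [/BS//|n2n] := leqP n n2.
rewrite -(subnK (ltnW n2n)); elim: (n - n2)%N => [|k ih]; first exact: BS.
rewrite addSn; set m := (k + n2)%N in ih *.
have n2m : (n2 <= m)%N by rewrite leq_addl.
rewrite (le_trans (rec m _ (gP _ n2m)))//.
  by rewrite (leq_trans (leq_maxl n0 n1)).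
have gm0 : 0 < gamma m.+1 by exact: step_gt0.
have B2 : beta <= alpha * B.
  by rewrite -ler_pdivrMl// mulrC /B lerDl sumr_ge0.
have h1 : (1 - alpha * gamma m.+1) * e m <= (1 - alpha * gamma m.+1) * B.
  by rewrite ler_wpM2l// subr_ge0 gP.
have h2 : gamma m.+1 * beta <= gamma m.+1 * (alpha * B) by rewrite ler_wpM2l// ltW.
by lra.
Qed.

(** Integrating the drift inequality over the law at time [n] yields the affine
    recursion; it is only known on the support, which has full measure. *)
Lemma lyapunov_moments (V : E -> R) (n0 : nat) (alpha beta : R) :
  measurable_fun setT V -> (forall x, 0 <= V x) ->
  (forall n, 'E_Pr[V \o y n] < +oo)%E ->
  0 < alpha -> 0 < beta ->
  (forall n x, (n0 <= n)%N -> Supp (law n) x ->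
     (chain_gen gamma K n V x <= (- alpha * V x + beta)%:E)%E) ->
  exists B : R, forall n, (\int[law n]_x (V x)%:E <= B%:E)%E.
Proof.
move=> mV V0 Vfin a0 b0 drift.
have eV n : (\int[law n]_x (V x)%:E = (\int[law n]_x V x)%:E)%E.
  rewrite /Rintegral fineK// ge0_fin_numE -?expectation_law//.
  by rewrite expectation_law// integral_ge0// => x _; rewrite lee_fin.
have [||B BP] := @affine_recursion_bounded (fun n => \int[law n]_x V x) n0
  alpha beta a0 (ltW b0); last first.
- by exists B => n; rewrite eV lee_fin.
- move=> n n0n ag; rewrite -lee_fin -eV.
  have g0 : 0 < gamma n.+1 by exact: step_gt0.
  have mVe : measurable_fun setT (EFin \o V) by exact/measurable_EFinP.
  rewrite (integral_law_step hy)//.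
  have ag0 : 0 <= 1 - alpha * gamma n.+1 by rewrite subr_ge0.
  apply: (@le_trans _ _ (\int[law n]_x
      ((1 - alpha * gamma n.+1)%:E * (V x)%:E + (gamma n.+1 * beta)%:E))%E).
    apply: ae_ge0_le_integral => //.
    + by move=> x _; apply: integral_ge0 => z _; rewrite lee_fin.
    + by apply: measurable_ge0_integral_ker => // z; rewrite lee_fin.
    + by move=> x _; rewrite -EFinM -EFinD lee_fin addr_ge0 ?mulr_ge0// ltW.
    + by apply: emeasurable_funD => //; exact: measurable_funeM.
    have [N [mN N0 sN]] := negligible_not_Supp (law n).
    exists N; split => // x /= h; apply: sN => Sx; apply: h => _.
    rewrite (le_trans (integral_chain_gen_le g0 mV V0 (drift n x n0n Sx)))//.
    by rewrite -EFinM -EFinD lee_fin; lra.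
  rewrite ge0_integralD//; first last.
  + by move=> x _; rewrite lee_fin mulr_ge0// ltW.
  + exact: measurable_funeM.
  + by move=> x _; rewrite -EFinM lee_fin mulr_ge0.
  rewrite ge0_integralZl_EFin//; last by move=> x _; rewrite lee_fin.
  by rewrite integral_cst// lawT mule1 eV -EFinM -EFinD lexx.
- by move=> n; apply: Rintegral_ge0.
Qed.

(** Under the Lyapunov condition, [chi d] is at most [V] outside a ball and is
    bounded inside it. *)
Lemma chi_moments (d1 : 'I_D -> nat) :
  (exists2 d : 'I_D -> nat, mle d1 d &
     (exists M2 : R, forall n : nat, ('E_Pr[chi d \o y n] <= M2%:E)%E)
     \/
     (exists V : E -> R,
        [/\ measurable_fun setT V,
            forall x, 0 <= V x,
            forall n : nat, ('E_Pr[V \o y n] < +oo)%E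
          & exists (n0 : nat) (a alpha beta : R),
              [/\ (1 <= n0)%N, 0 < a, 0 < alpha & 0 < beta] /\
              (forall x, a < `|x| -> chi d x <= V x) /\
              (forall (n : nat) (x : E), (n0 <= n)%N -> Supp (law n) x ->
                 (chain_gen gamma K n V x <= (- alpha * V x + beta)%:E)%E)])) ->
  exists2 B : R, 0 <= B & forall n, (\int[law n]_x (chi d1 x)%:E <= B%:E)%E.
Proof.
move=> [d d1d]; suff h : forall M : R, (forall n, (\int[law n]_x (chi d x)%:E <= M%:E)%E) ->
    exists2 B : R, 0 <= B & forall n, (\int[law n]_x (chi d1 x)%:E <= B%:E)%E.
  move=> [[M2 M2P]|[V [mV V0 Vfin [n0 [a [alpha [beta [[_ a0 al0 b0] [Vchi drift]]]]]]]]].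
    by apply: (h M2) => n; rewrite -expectation_law//; exact: measurable_chi.
  have [B BP] := lyapunov_moments mV V0 Vfin al0 b0 drift.
  pose c := \sum_(i < D) \sum_(0 <= k < (d i).+1) a ^+ k.
  have c0 : 0 <= c.
    by apply: sumr_ge0 => i _; apply: sumr_ge0 => k _; rewrite exprn_ge0// ltW.
  apply: (h (B + c)) => n.
  apply: (@le_trans _ _ (\int[law n]_x ((V x)%:E + c%:E))%E).
    apply: ge0_le_integral => //.
    - by move=> x _; rewrite lee_fin chi_ge0.
    - by apply/measurable_EFinP; exact: measurable_chi.
    - by apply: emeasurable_funD => //; apply/measurable_EFinP.
    - move=> x _; rewrite -EFinD lee_fin.
      have [xa|/Vchi xa] := leP `|x| a; last by rewrite (le_trans xa)// lerDl.
      by rewrite (le_trans (chi_le_ball _ xa))// lerDr.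
  rewrite ge0_integralD//; first last.
  - exact/measurable_EFinP.
  - by move=> x _; rewrite lee_fin.
  rewrite integral_cst// lawT mule1 EFinD; apply: leeD2r; exact: BP.
move=> M MP; exists `|M| => // n.
apply: (@le_trans _ _ M%:E); last by rewrite lee_fin ler_norm.
apply: le_trans (MP n); apply: ge0_le_integral => //.
- by move=> x _; rewrite lee_fin chi_ge0.
- by apply/measurable_EFinP; exact: measurable_chi.
- by apply/measurable_EFinP; exact: measurable_chi.
- by move=> x _; rewrite lee_fin chi_le.
Qed.

End Moments.

(** * The chain follows the semiflow *)

Section ClassFFacts.
Context (R : realType) (D : nat).
Notation E := 'rV[R]_D.
Variable P : R -> R.-pker E ~> E.
Variable N2 : 'I_D -> nat.

Lemma classF_bounds f : classF P N2 f ->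
  [/\ is_generator P f (gen P f), is_generator P (gen P f) (gen P (gen P f)),
      mbounded 1 f, Cbdiff N2 f & (Cnorm N2 f <= 1)%E] /\
  (forall x, `|gen P f x| <= 1) /\ (forall x, `|gen P (gen P f) x| <= 1).
Proof.
move=> [df Cf dLf sum1].
have s1 := sup_norm_ge0 (gen P f); have s2 := sup_norm_ge0 (gen P (gen P f)).
have s3 := Cnorm_ge0 N2 f.
have C1 : (Cnorm N2 f <= 1)%E.
  by apply: le_trans sum1; rewrite leeDr// adde_ge0.
split; [split=> //; try exact: dom_gen|split].
- have [/bounded_measurableP[M [mf _]] _ _] := dom_gen df; split=> //.
  by apply/sup_norm_leP; exact: le_trans (sup_norm_le_Cnorm N2 f) C1.
- apply/sup_norm_leP; apply: le_trans sum1.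
  by rewrite -addeA leeDl// adde_ge0.
- apply/sup_norm_leP; apply: le_trans sum1.
  by rewrite addeAC leeDr// adde_ge0.
Qed.

End ClassFFacts.

Section Approximation.
Context (R : realType) (D : nat).
Notation E := 'rV[R]_D.
Context (P : R -> R.-pker E ~> E) (CK : chapman_kolmogorov P).
Context (dy : measure_display) (Omega : measurableType dy)
  (Pr : probability Omega R) (y : nat -> {RV Pr >-> E})
  (K : nat -> R.-pker E ~> E) (hy : markov_chain y K)
  (gamma : nat -> R) (hgamma : step_sequence gamma)
  (d1 N1 N2 : 'I_D -> nat)
  (epsilon : nat -> R) (hepsilon : nonincreasing_to0 epsilon)
  (M1 : R)
  (h1 : forall f : E -> R, dom P f -> Cbdiff N1 f ->
     forall (n : nat) (x : E), (1 <= n)%N ->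
       Supp (distribution Pr (y n)) x ->
       (`| (gen P f x)%:E - chain_gen gamma K n f x |
          <= (M1 * chi d1 x)%:E * Cnorm N1 f * (epsilon n)%:E)%E)
  (C : R -> R)
  (h2 : forall T : R, 0 < T -> forall t : R, 0 <= t <= T ->
     forall f : E -> R, Cbdiff N2 f ->
       Cbdiff N1 (sg P t f) /\
       (forall j : 'I_D -> nat, mle j N1 -> forall x : E,
          ((`| mderiv j (sg P t f) x |)%:E <= (C T)%:E * Cnorm N2 f)%E))
  (B : R) (B0 : 0 <= B)
  (hB : forall n, (\int[distribution Pr (y n)]_x (chi d1 x)%:E <= B%:E)%E).
Local Notation law n := (distribution Pr (y n)).

Let lawT n : (law n : {measure set E -> \bar R}) setT = 1%E.
Proof. exact: probability_setT. Qed.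

Lemma chain_genE n g M x : mbounded M g ->
  chain_gen gamma K n g x = ((gamma n.+1)^-1 * (kavg (K n) g x - g x))%:E.
Proof.
move=> bg; rewrite /chain_gen.
have K1 := prob_kernel (s := K n) x.
have bc := @mbounded_cst _ E R (g x).
by rewrite (RintE K1 (mboundedB bg bc)) (RintB K1 bg bc) Rint_cst// EFinM.
Qed.

(** Both one-step means are compared with [g + gamma n.+1 * g1]: the chain by the
    convergence of the generators, the semigroup by [sg_taylor]. *)
Lemma one_step_error n g g1 g2 M G c : (1 <= n)%N ->
  mbounded M g -> is_generator P g g1 -> is_generator P g1 g2 ->
  (forall x, `|g2 x| <= G) -> 0 <= G ->
  Cbdiff N1 g -> 0 <= c -> (Cnorm N1 g <= c%:E)%E ->
  `|\int[law n.+1]_x g x - \int[law n]_x sg P (gamma n.+1) g x| <=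
    gamma n.+1 * (`|M1| * B * c * epsilon n + gamma n.+1 * G).
Proof.
move=> n1 bg gg1 g12 g2G G0 Cg c0 gc.
have e0 : 0 <= epsilon n by exact: nonincreasing_to0_ge0.
have g0 : 0 < gamma n.+1 by exact: (step_gt0 hgamma).
rewrite (Rint_law_step hy n bg).
have bK := mbounded_kavg (K n) bg; have bS := mbounded_sg P (gamma n.+1) bg.
rewrite -(RintB (lawT n) bK bS).
set h := fun x => kavg (K n) g x - sg P (gamma n.+1) g x.
have bh : mbounded (M + M) h by exact: mboundedB.
pose a := gamma n.+1 * (`|M1| * c * epsilon n).
have a0 : 0 <= a by rewrite /a !mulr_ge0// ltW.
(* a * chi d1 is the error of the chain, the square that of the semigroup *)
have hle x : Supp (law n) x -> `|h x| <= a * chi d1 x + gamma n.+1 ^+ 2 * G.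
  move=> Sx; have dg : dom P g by exists g1.
  have := h1 dg Cg n1 Sx; rewrite (genE gg1) (chain_genE n x bg).
  have ch0 := chi_ge0 d1 x.
  have Cfin : (Cnorm N1 g = (fine (Cnorm N1 g))%:E)%E.
    by rewrite fineK// ge0_fin_numE ?Cnorm_ge0// (le_lt_trans gc)// ltry.
  move: gc; have := Cnorm_ge0 N1 g; rewrite Cfin.
  rewrite -EFinB -!EFinM !lee_fin => q0 qc hh.
  have ta := sg_taylor CK x gg1 g12 g2G (ltW g0).
  have h3 : `|gamma n.+1 * g1 x - (kavg (K n) g x - g x)| <= a * chi d1 x.
    have -> : gamma n.+1 * g1 x - (kavg (K n) g x - g x) =
      gamma n.+1 * (g1 x - (gamma n.+1)^-1 * (kavg (K n) g x - g x)).
      by rewrite mulrBr mulVKf ?gt_eqF.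
    rewrite normrM gtr0_norm// /a -!mulrA ler_pM2l//.
    apply: le_trans hh _.
    rewrite [leRHS](_ : _ = (`|M1| * chi d1 x * c) * epsilon n); last by ring.
    apply: ler_wpM2r => //; apply: (@le_trans _ _ (`|M1| * chi d1 x * fine (Cnorm N1 g))).
      by rewrite !ler_wpM2r// ler_norm.
    by rewrite ler_wpM2l// mulr_ge0.
  have -> : h x = (sg P (gamma n.+1) g x - g x - gamma n.+1 * g1 x) * -1 -
     (gamma n.+1 * g1 x - (kavg (K n) g x - g x)) by rewrite /h; ring.
  by rewrite (le_trans (ler_normB _ _))// addrC lerD// normrM normrN1 mulr1.
have mch := @measurable_chi R D d1.
rewrite -lee_fin.
apply: (@le_trans _ _ (\int[law n]_x `|(h x)%:E|)%E).
  rewrite -abse_EFin -(RintE (lawT n) bh).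
  by apply: le_abse_integral => //; apply/measurable_EFinP; exact: bh.1.
apply: (@le_trans _ _ (\int[law n]_x (a%:E * (chi d1 x)%:E + (gamma n.+1 ^+ 2 * G)%:E))%E).
  have mhe : measurable_fun setT (fun x => `|(h x)%:E|)%E.
    by apply: measurableT_comp => //; apply/measurable_EFinP; exact: bh.1.
  apply: ae_ge0_le_integral => //.
  - move=> x _; rewrite -EFinM -EFinD lee_fin.
    by apply: addr_ge0; apply: mulr_ge0 => //; [exact: chi_ge0|exact: sqr_ge0].
  - by apply: emeasurable_funD => //; apply: measurable_funeM; apply/measurable_EFinP.
  have [N [mN N0 sN]] := negligible_not_Supp (law n).
  exists N; split => // x /= h'; apply: sN => Sx; apply: h' => _.
  by rewrite -EFinM -EFinD lee_fin hle.
rewrite ge0_integralD//; first last.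
- by move=> x _; rewrite lee_fin mulr_ge0// sqr_ge0.
- by apply: measurable_funeM; apply/measurable_EFinP.
- by move=> x _; rewrite -EFinM lee_fin mulr_ge0// chi_ge0.
rewrite ge0_integralZl_EFin//; first last.
- by apply/measurable_EFinP.
- by move=> x _; rewrite lee_fin chi_ge0.
rewrite integral_cst// lawT mule1.
have aB : (a%:E * \int[law n]_x (chi d1 x)%:E <= a%:E * B%:E)%E.
  by apply: lee_wpmul2l; [rewrite lee_fin|exact: hB].
apply: (le_trans (leeD2r _ aB)); rewrite -EFinM -EFinD lee_fin.
by rewrite le_eqVlt; apply/orP; left; apply/eqP; rewrite /a; ring.
Qed.

Definition mesh (n : nat) : R := Num.max (gamma n) (epsilon n).

Lemma mesh_gt0 n : (1 <= n)%N -> 0 < mesh n.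
Proof. by move=> n1; rewrite lt_max (step_gt0 hgamma). Qed.

Lemma mesh_le m n : (1 <= m <= n)%N -> mesh n <= mesh m.
Proof.
move=> mn; have [_ [gdec _] _] := hgamma; have [edec _] := hepsilon.
by rewrite ge_max !le_max gdec// edec// orbT.
Qed.

Definition nb_derivs : R := #|{dffun forall i : 'I_D, 'I_(N1 i).+1}|%:R.

(** The hypothesis on derivatives says nothing on the sign of [C T]; it remains
    valid for the positive part, with which error terms can be enlarged. *)
Definition cplus (T : R) := Num.max (C T) 0.

Lemma sg_Cnorm f t T : 0 < T -> 0 <= t <= T -> Cbdiff N2 f ->
  (Cnorm N2 f <= 1)%E ->
  Cbdiff N1 (sg P t f) /\ (Cnorm N1 (sg P t f) <= (nb_derivs * cplus T)%:E)%E.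
Proof.
move=> T0 tT Cf f1; have [Csg hsg] := h2 T0 tT Cf; split=> //.
apply: Cnorm_le => j jN x; rewrite -lee_fin (le_trans (hsg j jN x))//.
apply: (@le_trans _ _ ((cplus T)%:E * Cnorm N2 f)%E).
  by apply: lee_wpmul2r; [exact: Cnorm_ge0|rewrite lee_fin le_max lexx].
rewrite -[leRHS]mule1; apply: lee_wpmul2l => //.
by rewrite lee_fin le_max lexx orbT.
Qed.

Definition approx_const : R := `|M1| * B * nb_derivs + 2.

Let cplus0 T : 0 <= cplus T. Proof. by rewrite le_max lexx orbT. Qed.

(** Move from time [m] to time [n] one step at a time, exchanging at each step a
    step of the chain for the same duration of the semigroup: at step [k] the
    test function is [P_(tau n - tau k.+1) f], to which [one_step_error] applies
    with bounds that do not depend on [k]. *)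
Lemma telescoped_error f m n T : classF P N2 f -> (1 <= m <= n)%N -> 0 < T ->
  tau gamma n - tau gamma m <= T ->
  `|\int[law n]_x f x - \int[law m]_x sg P (tau gamma n - tau gamma m) f x|
    <= (`|M1| * B * nb_derivs + 1) * (1 + cplus T) * mesh m *
       (tau gamma n - tau gamma m).
Proof.
move=> Ff /andP[m1 mn] T0 nmT.
have [[fL LLL bf Cf f1] [L1 LL1]] := classF_bounds Ff.
set A := (_ * (1 + _) * _).
have -> : \int[law n]_x f x = \int[law n]_x sg P (tau gamma n - tau gamma n) f x.
  by rewrite subrr (sg0 CK bf).
have ind k : (m <= k)%N -> (k <= n)%N ->
  `|\int[law k]_x sg P (tau gamma n - tau gamma k) f x -
    \int[law m]_x sg P (tau gamma n - tau gamma m) f x| <=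
  A * (tau gamma k - tau gamma m).
  move=> /subnK <-; elim: (k - m)%N => [_|j ih jn].
    by rewrite add0n !subrr normr0 mulr0.
  rewrite addSn in jn *; set i := (j + m)%N in ih jn *.
  have mi : (m <= i)%N by rewrite leq_addl.
  have i1 : (1 <= i)%N by exact: leq_trans mi.
  have g0 : 0 < gamma i.+1 by exact: (step_gt0 hgamma).
  pose r := tau gamma n - tau gamma i.+1.
  have r0 : 0 <= r by rewrite subr_ge0 (tau_le hgamma).
  have rT : 0 <= r <= T.
    rewrite r0 (le_trans _ nmT)// lerB// (tau_le hgamma)//.
    exact: leq_trans mi (leqnSn i).
  have rE : tau gamma n - tau gamma i = gamma i.+1 + r by rewrite /r tauS; ring.
  have gg1 := is_generator_sg CK r0 fL; have g12 := is_generator_sg CK r0 LLL.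
  have [Cg gc] := sg_Cnorm T0 rT Cf f1.
  have g2G x : `|sg P r (gen P (gen P f)) x| <= 1.
    apply: Rint_norm; first exact: prob_kernel.
    by split => //; have [_ /bounded_measurableP[? []]] := LLL.
  have c0 : 0 <= nb_derivs * cplus T by exact: mulr_ge0.
  have := one_step_error i1 (mbounded_sg P r bf) gg1 g12 g2G ler01 Cg c0 gc.
  rewrite -(sg_comp CK bf (ltW g0) r0) -rE => st.
  have {}ih := ih (ltnW jn).
  set x1 := Rintegral _ _ _ in st; set x2 := Rintegral _ _ _ in st ih.
  set x3 := Rintegral _ _ _ in ih.
  rewrite -/r -/x1 -/x3.
  have -> : x1 - x3 = (x1 - x2) + (x2 - x3) by ring.
  rewrite (le_trans (ler_normD _ _))// (le_trans (lerD st ih))// tauS.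
  rewrite -subr_ge0.
  have -> : A * (tau gamma i + gamma i.+1 - tau gamma m) -
    (gamma i.+1 * (`|M1| * B * (nb_derivs * cplus T) * epsilon i + gamma i.+1 * 1)
     + A * (tau gamma i - tau gamma m)) = gamma i.+1 * (A -
      (`|M1| * B * nb_derivs * cplus T * epsilon i + gamma i.+1)) by ring.
  rewrite mulr_ge0 ?(ltW g0)// subr_ge0 /A.
  have mm0 := mesh_gt0 m1.
  have em : epsilon i <= mesh m.
    by rewrite (le_trans _ (@mesh_le m i _)) ?m1// le_max lexx orbT.
  have gm : gamma i.+1 <= mesh m.
    rewrite (le_trans _ (@mesh_le m i.+1 _)) ?m1 ?(leq_trans mi)//.
    by rewrite le_max lexx.
  have a0 : 0 <= `|M1| * B * nb_derivs by rewrite !mulr_ge0.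
  have e1 : `|M1| * B * nb_derivs * cplus T * epsilon i <=
    `|M1| * B * nb_derivs * cplus T * mesh m by rewrite ler_wpM2l// mulr_ge0.
  apply: le_trans (lerD e1 gm) _.
  rewrite -subr_ge0; set a := `|M1| * B * nb_derivs in a0 *.
  have -> : (a + 1) * (1 + cplus T) * mesh m - (a * cplus T * mesh m + mesh m) =
    (a + cplus T) * mesh m by ring.
  by rewrite mulr_ge0 ?(ltW mm0)// addr_ge0.
by apply: ind => //.
Qed.

(** [t] and [t + s] are not exactly times of the chain: the durations [s] and
    [tau n - tau m] differ by at most [gamma m], which by [sg_lipschitz] costs one
    more mesh.  This is also why [T] must exceed [s] by one step. *)
Lemma flow_approximation f s t T : classF P N2 f -> 0 <= s -> 0 <= t ->
  (1 <= step_index gamma t)%N -> s + gamma 1 <= T ->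
  `|\int[interp_law gamma y (t + s)]_x f x -
    \int[flow P (interp_law gamma y t) s]_x f x| <=
  approx_const * (1 + T * (1 + cplus T)) * mesh (step_index gamma t).
Proof.
move=> Ff s0 t0; set m := step_index gamma t => m1 sT.
have [[fL LLL bf Cf f1] [L1 LL1]] := classF_bounds Ff.
rewrite /flow (Rint_kact _ _ bf) /interp_law -/m.
set n := step_index gamma (t + s).
have ts0 : 0 <= t + s by exact: addr_ge0.
have mn : (m <= n)%N by apply: (step_index_le hgamma) => //; rewrite lerDl.
have /andP[m_t t_m] := step_indexP hgamma t0.
have /andP[n_t t_n] := step_indexP hgamma ts0.
rewrite -/m -/n in m_t t_m n_t t_n.
rewrite tauS in t_m; rewrite tauS in t_n.
have [_ [gdec _] _] := hgamma.
have gn : gamma n.+1 <= gamma m.+1 by apply: gdec.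
have gm : gamma m.+1 <= gamma m by apply: gdec; rewrite m1 leqnSn.
have gm1 : gamma m.+1 <= gamma 1 by apply: gdec.
have g1 : 0 < gamma 1 by exact: (step_gt0 hgamma).
have T0 : 0 < T by lra.
set s' := tau gamma n - tau gamma m.
have s'0 : 0 <= s' by rewrite subr_ge0 (tau_le hgamma).
have s'T : s' <= T by rewrite /s'; lra.
have ss' : `|s' - s| <= gamma m.
  by rewrite /s' ler_norml; apply/andP; split; lra.
have mn1 : (1 <= m <= n)%N by rewrite m1.
have tel := telescoped_error Ff mn1 T0 s'T.
rewrite -/s' in tel.
have lip a b x : 0 <= a -> a <= b -> `|sg P b f x - sg P a f x| <= b - a.
  move=> a0 ab; have ba0 : 0 <= b - a by rewrite subr_ge0.
  have -> : sg P b f = sg P a (sg P (b - a) f).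
    by rewrite -(sg_comp CK bf)// addrC subrK.
  rewrite -(sgB _ _ _ (mbounded_sg P (b - a) bf) bf).
  apply: Rint_norm; first exact: prob_kernel.
  split; first by exact: (mbounded_sg_sub _ _ bf).1.
  by move=> z; have := sg_lipschitz CK z fL L1 ba0; rewrite mulr1.
have lip' x : `|sg P s' f x - sg P s f x| <= gamma m.
  have [ab|/ltW ab] := leP s s'.
    by rewrite (le_trans (lip _ _ _ s0 ab))// (le_trans (ler_norm _)).
  rewrite distrC (le_trans (lip _ _ _ s'0 ab))//.
  by rewrite (le_trans (ler_norm _))// distrC.
set x1 := Rintegral _ _ _ in tel *; set x2 := Rintegral _ _ _ in tel.
set x3 := Rintegral _ _ _.
have x23 : `|x2 - x3| <= gamma m.
  rewrite -(RintB (lawT m) (mbounded_sg P s' bf) (mbounded_sg P s bf)).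
  apply: (Rint_norm (lawT m)); split=> //.
  exact: (mboundedB (mbounded_sg P s' bf) (mbounded_sg P s bf)).1.
have -> : x1 - x3 = (x1 - x2) + (x2 - x3) by ring.
rewrite (le_trans (ler_normD _ _))// (le_trans (lerD tel x23))//.
have mm0 := mesh_gt0 m1.
have gmm : gamma m <= mesh m by rewrite le_max lexx.
rewrite /approx_const; set a := `|M1| * B * nb_derivs.
have a0 : 0 <= a by rewrite !mulr_ge0.
have c0 := cplus0 T; set c := cplus T in c0 *.
apply: (@le_trans _ _ ((a + 1) * (1 + c) * mesh m * T + mesh m)).
  by rewrite lerD// ler_wpM2l// !mulr_ge0 ?addr_ge0// ltW.
rewrite -subr_ge0.
have -> : (a + 2) * (1 + T * (1 + c)) * mesh m -
   ((a + 1) * (1 + c) * mesh m * T + mesh m) =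
   (a + 1 + T * (1 + c)) * mesh m by ring.
by rewrite !mulr_ge0 ?addr_ge0 ?mulr_ge0 ?addr_ge0// ltW.
Qed.

End Approximation.

(** * Distances and the decay of the mesh *)

Section Distance.
Context (R : realType) (D : nat).
Notation E := 'rV[R]_D.
Implicit Types (H : set (E -> R)) (mu nu : probability E R).

Lemma dist_ge0 H mu nu : (0 <= dist H mu nu)%E.
Proof. by apply: ereal_sup_ubound; left. Qed.

Lemma dist_le H mu nu (r : R) : 0 <= r ->
  (forall f, H f -> exists M, mbounded M f /\
    `|\int[mu]_x f x - \int[nu]_x f x| <= r) ->
  (dist H mu nu <= r%:E)%E.
Proof.
move=> r0 h; apply: ge_ereal_sup => _ [->|[f Hf <-]]; first by rewrite lee_fin.
have [M [bf fr]] := h f Hf.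
rewrite (RintE (probability_setT mu) bf) (RintE (probability_setT nu) bf).
by rewrite -EFinB lee_fin.
Qed.

Lemma dist_ub H mu nu (r : R) M f : (dist H mu nu <= r%:E)%E -> H f -> mbounded M f ->
  `|\int[mu]_x f x - \int[nu]_x f x| <= r.
Proof.
move=> hd Hf bf; rewrite -lee_fin; apply: le_trans hd.
apply: ereal_sup_ubound; right; exists f => //.
by rewrite (RintE (probability_setT mu) bf) (RintE (probability_setT nu) bf).
Qed.

Lemma dist_le2 H mu nu : (forall f, H f -> mbounded 1 f) ->
  (dist H mu nu <= 2%:E)%E.
Proof.
move=> H1; apply: dist_le => // f /H1 bf; exists 1; split=> //.
rewrite (le_trans (ler_normB _ _))// (_ : 2 = 1 + 1)//.
by rewrite lerD// ?(Rint_norm (probability_setT mu) bf)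
  ?(Rint_norm (probability_setT nu) bf).
Qed.

(** The triangle inequality through [nu], where the first leg is only estimated
    on the smaller class [H]. *)
Lemma dist_step H H' mu nu (pi : probability E R) (a b : R) : H `<=` H' ->
  (forall f, H f -> mbounded 1 f) -> 0 <= a ->
  (forall f, H f -> `|\int[mu]_x f x - \int[nu]_x f x| <= a) ->
  (dist H' nu pi <= b%:E)%E -> (dist H mu pi <= (a + b)%:E)%E.
Proof.
move=> HH' H1 a0 ha hb.
have b0 : 0 <= b by rewrite -lee_fin; exact: (le_trans (dist_ge0 H' nu pi) hb).
apply: dist_le => [|f Hf]; first exact: addr_ge0.
exists 1; split; first exact: H1.
have := dist_ub hb (HH' _ Hf) (H1 _ Hf); have := ha f Hf.
set x := Rintegral _ _ _; set z := Rintegral _ _ _; set w := Rintegral _ _ _.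
move=> h1 h2; have -> : x - w = (x - z) + (z - w) by ring.
by rewrite (le_trans (ler_normD _ _))// lerD.
Qed.

End Distance.

Section MeshDecay.
Context (R : realType) (gamma epsilon : nat -> R).
Hypothesis hgamma : step_sequence gamma.

(** By definition of [lambda], [mesh n <= exp (- l * tau n)] for large [n]; the
    constant takes care of the finitely many other values. *)
Lemma mesh_decay (l : R) : (l%:E < lambda gamma epsilon)%E ->
  exists2 c : R, 0 < c & forall n, (1 <= n)%N ->
    mesh gamma epsilon n <= c * expR (- l * tau gamma n).
Proof.
rewrite /lambda lteNr => /ereal_inf_lt[_ [V [N _ NV] <-] hV].
have dec n : (N <= n)%N -> (1 <= n)%N -> mesh gamma epsilon n <= expR (- l * tau gamma n).
  move=> Nn n1.
  have tn0 : 0 < tau gamma n.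
    by rewrite (lt_le_trans (step_gt0 hgamma n1))// -(prednK n1) tauS lerDr tau_ge0.
  have m0 := mesh_gt0 hgamma epsilon n1.
  have : ((ln (mesh gamma epsilon n) / tau gamma n)%:E < (- l)%:E)%E.
    apply: le_lt_trans hV; apply: ereal_sup_ubound; exists n => //.
    exact: NV.
  rewrite lte_fin ltr_pdivrMr// => /ltW h; rewrite -[leLHS]lnK ?posrE// ler_expR//.
exists (1 + \sum_(0 <= k < N) `|mesh gamma epsilon k * expR (l * tau gamma k)|).
  by rewrite ltr_pwDl// sumr_ge0.
move=> n n1; set S := \sum_(_ <= _ < _) _.
have S0 : 0 <= S by exact: sumr_ge0.
have [Nn|nN] := leqP N n.
  rewrite (le_trans (dec _ Nn n1))// ler_peMl ?expR_ge0//.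
  by rewrite lerDl.
rewrite -ler_pdivrMr ?expR_gt0// -expRN mulNr opprK.
rewrite (le_trans (ler_norm _))// /S (big_rem n)/= ?mem_index_iota//.
by rewrite addrCA lerDl addr_ge0// sumr_ge0.
Qed.

End MeshDecay.

Lemma ereal_between (R : realType) (a : R) (b : \bar R) : (a%:E < b)%E ->
  exists2 l : R, a < l & (l%:E < b)%E.
Proof.
case: b => [b| |]//; last by exists (a + 1); rewrite ?ltrDl// ltry.
rewrite lte_fin => ab; exists ((a + b) / 2); first by rewrite ltr_pdivlMr//; lra.
by rewrite lte_fin ltr_pdivrMr//; lra.
Qed.

(** * Exponential rates *)

Section Rates.
Context (R : realType) (D : nat).
Notation E := 'rV[R]_D.
Context (gamma epsilon : nat -> R) (hgamma : step_sequence gamma)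
  (P : R -> R.-pker E ~> E) (mu : R -> probability E R)
  (F : set (E -> R)) (F1 : forall f, F f -> mbounded 1 f) (C : R -> R) (A : R).
Hypothesis A0 : 0 <= A.
Hypothesis flow_approx : forall f s t T, F f -> 0 <= s -> 0 <= t ->
  (1 <= step_index gamma t)%N -> s + gamma 1 <= T ->
  `|\int[mu (t + s)]_x f x - \int[flow P (mu t) s]_x f x| <=
  A * (1 + T * (1 + cplus C T)) * mesh gamma epsilon (step_index gamma t).

Let cplus0 T : 0 <= cplus C T. Proof. by rewrite le_max lexx orbT. Qed.

(** Before the first step the convergence of the generators is not available, but
    there [exp (- l t)] is bounded below and test functions are bounded by 1. *)
Lemma exponential_approximation l : 0 < l -> (l%:E < lambda gamma epsilon)%E ->
  exists2 c : R, 0 <= c & forall f s t T, F f -> 0 <= s -> 0 <= t ->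
    s + gamma 1 <= T ->
    `|\int[mu (t + s)]_x f x - \int[flow P (mu t) s]_x f x| <=
    c * (1 + T * (1 + cplus C T)) * expR (- l * t).
Proof.
move=> l0 /(mesh_decay hgamma)[c c0 cP].
have g1 : 0 < gamma 1 by exact: (step_gt0 hgamma).
exists ((A * c + 2) * expR (l * gamma 1)).
  by rewrite mulr_ge0 ?expR_ge0// addr_ge0// mulr_ge0// ltW.
move=> f s t T Ff s0 t0 sT.
have T0 : 0 <= T by lra.
set X := 1 + _; have X1 : 1 <= X by rewrite /X lerDl mulr_ge0// addr_ge0.
have X0 : 0 <= X by lra.
have /andP[m_t t_m] := step_indexP hgamma t0.
rewrite tauS in t_m; set m := step_index gamma t in m_t t_m *.
have hexp : expR (- l * tau gamma m) <= expR (l * gamma 1) * expR (- l * t).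
  rewrite -expRD ler_expR -subr_ge0.
  have -> : l * gamma 1 + - l * t - - l * tau gamma m =
    l * (gamma 1 + tau gamma m - t) by ring.
  have [_ [gdec _] _] := hgamma.
  have gm1 : gamma m.+1 <= gamma 1 by apply: gdec.
  by rewrite mulr_ge0 ?(ltW l0)//; lra.
have [m0|m1] := posnP m; last first.
  apply: le_trans (flow_approx Ff s0 t0 m1 sT) _; rewrite -/X -/m.
  have h1 : mesh gamma epsilon m <= c * (expR (l * gamma 1) * expR (- l * t)).
    by rewrite (le_trans (cP _ m1))// ler_pM2l.
  have := ler_wpM2l (mulr_ge0 A0 X0) h1 => /le_trans; apply.
  rewrite -subr_ge0.
  have -> : (A * c + 2) * expR (l * gamma 1) * X * expR (- l * t) -
    A * X * (c * (expR (l * gamma 1) * expR (- l * t))) =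
    2 * expR (l * gamma 1) * X * expR (- l * t) by ring.
  by rewrite !mulr_ge0 ?expR_ge0.
apply: (@le_trans _ _ 2).
  have bf := F1 Ff.
  rewrite (le_trans (ler_normB _ _))// (_ : 2 = 1 + 1)//.
  by rewrite lerD//; [exact: (Rint_norm (probability_setT _) bf)
                    |exact: (Rint_norm (probability_setT _) bf)].
move: hexp; rewrite m0 tau0 mulr0 expR0.
set e1 := expR _; set e2 := expR _ => he.
have e12 : 0 <= e1 * e2 by rewrite mulr_ge0 ?expR_ge0.
have -> : (A * c + 2) * e1 * X * e2 = (A * c + 2) * X * (e1 * e2) by ring.
have hh : 2 <= (A * c + 2) * X.
  have : 0 <= A * c * X by rewrite !mulr_ge0// ltW.
  by lra.
by rewrite -[leLHS]mulr1 ler_pM.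
Qed.

Variables (pi : probability E R) (v M3 : R) (hv : 0 < v) (hM3 : 0 < M3)
  (G : set (E -> R)).

(** For [th >= t0] one has [M3 exp (- v th) <= exp (- u th)], so a window of
    length [th] multiplies the distance by [exp (- u th)] and adds an error
    [c' exp (- l k th)], where [l > u].  A long time is cut into equal windows of
    length between [t0 + 1] and [2 (t0 + 1)]: bounded above so that one constant
    [C T] serves for all, and below so that the geometric series of ratio
    [exp (- (l - u) th)] has a uniformly bounded sum.  A time less than [t0 + 1]
    is covered by the trivial bound 2 on the distance. *)
Lemma contraction_rate : G `<=` F ->
   (forall (nu : probability E R) (t : R), 0 < t ->
      (dist G (flow P nu t) pi <= dist G nu pi * (M3 * expR (- v * t))%:E)%E) ->
   (0 < lambda gamma epsilon)%E ->
   forall u : R, (u%:E < Order.min (lambda gamma epsilon) v%:E)%E ->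
   exists M5 : R, forall t : R, (v - u)^-1 * ln (Num.max 1 M3) < t ->
     (dist G (mu t) pi <= (M5%:E + dist G (mu 0%R) pi) * (expR (- u * t))%:E)%E.
Proof.
move=> GF contr lam0 u; rewrite lt_min lte_fin => /andP[ulam uv].
have G1 f : G f -> mbounded 1 f by move=> /GF/F1.
have [l ul llam] : exists2 l, Num.max u 0 < l & (l%:E < lambda gamma epsilon)%E.
  by apply: ereal_between; rewrite EFin_max gt_max ulam lam0.
move: ul; rewrite gt_max => /andP[ul l0].
have [c c0 cP] := exponential_approximation l0 llam.
set t0 := (v - u)^-1 * _.
have vu : 0 < v - u by rewrite subr_gt0.
have mx1 : 1 <= Num.max 1 M3 by rewrite le_max lexx.
have t00 : 0 <= t0 by rewrite mulr_ge0 ?invr_ge0 ?ln_ge0// ltW.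
pose Th := t0 + 1; have Th1 : 1 <= Th by rewrite /Th lerDr.
have Th0 : 0 < Th by lra.
pose T := Th + Th + gamma 1.
pose c' := c * (1 + T * (1 + cplus C T)).
have g1 : 0 < gamma 1 by exact: (step_gt0 hgamma).
have T0 : 0 <= T by rewrite /T; lra.
have c'0 : 0 <= c' by rewrite mulr_ge0// addr_ge0// mulr_ge0// addr_ge0.
have M3exp th : t0 <= th -> M3 * expR (- v * th) <= expR (- u * th).
  move=> tth; have h : M3 <= expR ((v - u) * th).
    apply: (@le_trans _ _ (expR (ln (Num.max 1 M3)))).
      by rewrite lnK ?posrE ?(lt_le_trans ltr01)// le_max lexx orbT.
    by rewrite ler_expR -ler_pdivrMl.
  have -> : - u * th = (v - u) * th + (- v * th) by ring.
  by rewrite expRD ler_wpM2r ?expR_ge0.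
have [a0 a00 distE] : exists2 a0 : R, 0 <= a0 & dist G (mu 0) pi = a0%:E.
  have := dist_le2 (mu 0) pi G1; have := dist_ge0 G (mu 0) pi.
  by case: dist => [r| |]//; rewrite lee_fin => r0 _; exists r.
pose q0 := expR (- (l - u) * Th).
have q01 : q0 < 1 by rewrite expR_lt1 mulNr oppr_lt0 mulr_gt0// subr_gt0.
pose S := c' * expR (`|u| * (Th + Th)) / (1 - q0).
have S0 : 0 <= S.
  by rewrite mulr_ge0 ?invr_ge0 ?subr_ge0 ?(ltW q01)// mulr_ge0 ?expR_ge0.
exists (S + 2 * expR (`|u| * Th)) => t tt.
rewrite distE -EFinD -EFinM.
have [tTh|Tht] := ltP t Th.
  apply: (le_trans (dist_le2 _ _ G1)); rewrite lee_fin.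
  have h1 : 1 <= expR (`|u| * Th) * expR (- u * t).
    rewrite -expRD -expR0 ler_expR mulNr subr_ge0.
    rewrite (le_trans (ler_norm _))// normrM ler_wpM2l// ger0_norm; lra.
  rewrite -subr_ge0; set e1 := expR _ in h1 *; set e2 := expR _ in h1 *.
  have -> : (S + 2 * e1 + a0) * e2 - 2 = (S + a0) * e2 + 2 * (e1 * e2 - 1) by ring.
  apply: addr_ge0; apply: mulr_ge0 => //; last by rewrite subr_ge0.
    exact: addr_ge0.
  exact: expR_ge0.
have t_0 : 0 < t by lra.
have [n n0 [th [th1 th2 tE]]] : exists2 n : nat, (0 < n)%N & exists th,
    [/\ Th <= th, th <= Th + Th & t = n%:R * th].
  have tT0 : 0 <= t / Th by rewrite divr_ge0// ltW.
  pose n := Num.truncn (t / Th).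
  have /andP[nt tn] := truncn_itv tT0; rewrite -/n in nt tn.
  have n0 : (0 < n)%N.
    rewrite -ltnS -(ltr_nat R) (le_lt_trans _ tn)// ler_pdivlMr// mul1r//.
  have nR0 : 0 < n%:R :> R by rewrite ltr0n.
  exists n => //; exists (t / n%:R); split.
  - by rewrite ler_pdivlMr// mulrC -ler_pdivlMr.
  - rewrite ler_pdivrMr// mulrDl -mulrDr; apply: (@le_trans _ _ (Th * n.+1%:R)).
      by rewrite mulrC -ler_pdivrMr// ltW.
    by rewrite ler_pM2l// -natrD ler_nat -addn1 leq_add2l.
  - by rewrite mulrC divfK// gt_eqF.
have th0 : 0 < th by lra.
pose q := expR (- (l - u) * th).
have lu : 0 < l - u by rewrite subr_gt0.
have qq0 : q <= q0 by rewrite ler_expR !mulNr lerN2 ler_pM2l.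
have q1 : q < 1 by exact: le_lt_trans q01.
have q_0 : 0 < q by exact: expR_gt0.
(* the sum of the geometric series of the errors brought back to time 0 *)
pose S' := c' * expR (u * th) / (1 - q).
have S'S : S' <= S.
  apply: ler_pM.
  - by rewrite mulr_ge0 ?expR_ge0.
  - by rewrite invr_ge0 subr_ge0 ltW.
  - apply: ler_wpM2l => //; rewrite ler_expR (le_trans (ler_norm _))// normrM.
    by apply: ler_wpM2l => //; rewrite gtr0_norm.
  - by rewrite lef_pV2 ?posrE ?subr_gt0// lerB.
have ind k : (dist G (mu (k%:R * th)) pi <=
    (expR (- u * (k%:R * th)) * (a0 + S' * (1 - q ^+ k)))%:E)%E.
  elim: k => [|k ih].
    by rewrite mul0r mulr0 expR0 mul1r expr0 subrr mulr0 addr0 distE.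
  have k0 : 0 <= k%:R * th by rewrite mulr_ge0// ltW.
  rewrite -natr1 mulrDl mul1r.
  set tk := k%:R * th in ih k0 *.
  have hc := contr (mu tk) th th0.
  have {hc} hc : (dist G (flow P (mu tk) th) pi <=
     (expR (- u * tk) * (a0 + S' * (1 - q ^+ k)) * expR (- u * th))%:E)%E.
    apply: (le_trans hc); rewrite [leRHS]EFinM.
    apply: lee_pmul; rewrite ?dist_ge0// ?lee_fin ?mulr_ge0 ?expR_ge0 ?(ltW hM3)//.
    apply: M3exp; rewrite /Th in th1; lra.
  have happ f : G f -> `|\int[mu (tk + th)]_x f x - \int[flow P (mu tk) th]_x f x|
      <= c' * expR (- l * tk).
    move=> Gf; apply: cP => //; [exact: GF|exact: ltW|].
    by rewrite /T lerD2r.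
  have ce0 : 0 <= c' * expR (- l * tk) by rewrite mulr_ge0 ?expR_ge0.
  apply: (le_trans (dist_step (@subset_refl _ G) G1 ce0 happ hc)).
  rewrite lee_fin le_eqVlt; apply/orP; left; apply/eqP.
  have qk : q ^+ k = expR (- (l - u) * tk).
    by rewrite /q -expRM_natl /tk; congr expR; ring.
  have -> : expR (- u * (tk + th)) = expR (- u * tk) * expR (- u * th).
    by rewrite -expRD; congr expR; ring.
  have -> : expR (- l * tk) = expR (- u * tk) * q ^+ k.
    by rewrite qk -expRD; congr expR; ring.
  have e1 : expR (- u * th) * expR (u * th) = 1.
    by rewrite -expRD mulNr addNr expR0.
  have S'q : S' * (1 - q) = c' * expR (u * th).
    by rewrite /S' divfK// subr_eq0 gt_eqF.
  have e2 : expR (- u * th) * (S' * (1 - q)) = c'.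
    by rewrite S'q mulrCA e1 mulr1.
  rewrite exprS; set eu := expR (- u * tk); set eh := expR (- u * th) in e1 e2 *.
  transitivity (eu * eh * (a0 + S' * (1 - q ^+ k)) +
     eu * q ^+ k * (eh * (S' * (1 - q)))); first by rewrite e2; ring.
  by ring.
rewrite tE; apply: (le_trans (ind n)); rewrite lee_fin mulrC.
rewrite ler_wpM2r ?expR_ge0//.
have h1 : S' * (1 - q ^+ n) <= S.
  have S'0 : 0 <= S'.
    by rewrite mulr_ge0 ?invr_ge0 ?subr_ge0 ?(ltW q1)// mulr_ge0 ?expR_ge0.
  apply: (le_trans _ S'S); rewrite ler_piMr// gerBl.
  by apply: exprn_ge0; exact: ltW.
have h2 : 0 <= 2 * expR (`|u| * Th) by rewrite mulr_ge0 ?expR_ge0.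
apply: (@le_trans _ _ (a0 + S)); first by rewrite lerD2l.
by rewrite addrC -[leRHS]addrA lerD2l lerDr.
Qed.

(** [l |-> v * l / (r + v + l)] increases, with limit [v], and takes the value
    [u > 0] at [l = u * (r + v) / (v - u)]; any [l] does if [u <= 0]. *)
Lemma rate_between (r u : R) (lam : \bar R) : 0 < r -> (0 < lam)%E ->
  (u%:E < rate r v lam)%E ->
  exists2 l : R, 0 < l /\ (l%:E < lam)%E & u <= v * l / (r + v + l).
Proof.
move=> r0 lam0 urate; have [u0|u0] := leP u 0.
  have [l l0 llam] := ereal_between lam0; exists l => //.
  by rewrite (le_trans u0)// divr_ge0 ?mulr_ge0 ?addr_ge0// ltW.
have uv : u < v.
  case: lam lam0 urate => [l| |]//=; rewrite !lte_fin// => l0 ul.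
  have rvl : 0 < r + v + l by rewrite !addr_gt0.
  apply: (lt_trans ul); rewrite ltr_pdivrMr//.
  by rewrite ltr_pM2l// ltrDr addr_gt0.
have vu : 0 < v - u by rewrite subr_gt0.
exists (u * (r + v) / (v - u)).
  split; first by rewrite divr_gt0// mulr_gt0//; lra.
  case: lam lam0 urate => [l| |]//=; rewrite ?ltry// !lte_fin => l0.
  have rvl : 0 < r + v + l by rewrite !addr_gt0.
  rewrite ltr_pdivlMr// ltr_pdivrMr// mulrDr.
  by rewrite -ltrBrDr mulrC (mulrC l) mulrBl.
have rv : r + v != 0 by rewrite gt_eqF//; lra.
rewrite le_eqVlt; apply/orP; left; apply/eqP.
have rvl : r + v + u * (r + v) / (v - u) = (r + v) * v / (v - u).
  by field; rewrite gt_eqF.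
rewrite rvl; field; apply/and3P; split; rewrite ?gt_eqF//; exact: addr_gt0.
Qed.

(** Approximation over the window [[t - al * t, t]] followed by the ergodicity of
    the flow. *)
Lemma uniform_ergodicity_rate (r M4 : R) : 0 < r -> 0 < M4 ->
   (forall s t : R, 0 < s -> 0 < t ->
      (dist G (flow P (mu s) t) pi <= (M3 * expR (- v * t))%:E)%E) ->
   (forall T : R, 0 < T -> T * C T <= M4 * expR (r * T)) ->
   (0 < lambda gamma epsilon)%E ->
   forall u : R, (u%:E < rate r v (lambda gamma epsilon))%E ->
   exists M5 : R, forall t : R, 0 < t ->
     (dist (F `&` G) (mu t) pi <= (M5 * expR (- u * t))%:E)%E.
Proof.
move=> r0 M40 erg CT lam0 u /(rate_between r0 lam0)[l [l0 llam] ul].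
have [c c0 cP] := exponential_approximation l0 llam.
have g1 : 0 < gamma 1 by exact: (step_gt0 hgamma).
(* the solution of r * al - l * (1 - al) = - v * al, which equates both errors *)
pose al := l / (r + v + l).
have rvl : 0 < r + v + l by rewrite !addr_gt0.
have al0 : 0 < al by exact: divr_gt0.
have al1 : al < 1 by rewrite ltr_pdivrMr// mul1r ltrDr addr_gt0.
pose c1 := c * (1 + r^-1 + M4) * expR (r * gamma 1).
have c10 : 0 <= c1.
  by rewrite !mulr_ge0 ?expR_ge0// !addr_ge0 ?invr_ge0// ltW.
exists (c1 + M3) => t t0.
have th0 : 0 < al * t by exact: mulr_gt0.
have s0 : 0 < t - al * t by rewrite subr_gt0 gtr_pMl.
have vale : expR (- v * (al * t)) <= expR (- u * t).
  by rewrite ler_expR !mulNr lerN2 mulrA ler_pM2r// /al mulrA.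
have happ f : (F `&` G) f -> `|\int[mu t]_x f x -
    \int[flow P (mu (t - al * t)) (al * t)]_x f x| <= c1 * expR (- v * (al * t)).
  move=> [Ff _].
  have := cP f (al * t) (t - al * t) (al * t + gamma 1) Ff (ltW th0) (ltW s0) (lexx _).
  rewrite subrK => /le_trans; apply.
  set T := al * t + gamma 1; have T0 : 0 < T by exact: addr_gt0.
  have eT1 : 1 <= expR (r * T) by rewrite -expR0 ler_expR mulr_ge0// ltW.
  have eT2 : T <= r^-1 * expR (r * T).
    by rewrite ler_pdivlMl// (le_trans _ (expR_ge1Dx _))// lerDr.
  have eT3 : T * cplus C T <= M4 * expR (r * T).
    rewrite /cplus /Num.max; case: ifP => _; last exact: CT.
    by rewrite mulr0 mulr_ge0 ?expR_ge0// ltW.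
  have hX : 1 + T * (1 + cplus C T) <= (1 + r^-1 + M4) * expR (r * T).
    have -> : 1 + T * (1 + cplus C T) = 1 + (T + T * cplus C T) by ring.
    have -> : (1 + r^-1 + M4) * expR (r * T) =
      expR (r * T) + (r^-1 * expR (r * T) + M4 * expR (r * T)) by ring.
    by rewrite lerD// lerD.
  have := ler_wpM2l c0 hX.
  move=> /(ler_wpM2r (expR_ge0 (- l * (t - al * t))))/le_trans; apply.
  rewrite le_eqVlt; apply/orP; left; apply/eqP.
  have e : al * (r + v + l) = l by rewrite /al divfK// gt_eqF.
  have ee : expR (r * T) * expR (- l * (t - al * t)) =
    expR (r * gamma 1) * expR (- v * (al * t)).
    rewrite -!expRD; congr expR.
    transitivity (r * gamma 1 + - v * (al * t) + t * (al * (r + v + l) - l)).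
      by rewrite /T; ring.
    by rewrite e subrr mulr0 addr0.
  transitivity (c * (1 + r^-1 + M4) * (expR (r * T) * expR (- l * (t - al * t)))).
    by ring.
  by rewrite ee /c1; ring.
apply: le_trans (dist_step (@subIsetr _ F G) _ _ happ (erg _ _ s0 th0)) _.
- by move=> f [/F1].
- by rewrite mulr_ge0 ?expR_ge0.
by rewrite -mulrDl lee_fin ler_wpM2l// addr_ge0// ltW.
Qed.

End Rates.

(** * Flat functions of one variable *)

Section FlatFunctions.
Context (R : realType).
Implicit Types (k : nat) (t : R).

(** [flat 0] is the standard smooth function vanishing on the negative half-line;
    the factor [t^-1 ^+ k] makes the family stable under derivation. *)
Definition flat k t : R := if 0 < t then t^-1 ^+ k * expR (- t^-1) else 0.

Lemma flat_ge0 k t : 0 <= flat k t.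
Proof.
rewrite /flat; case: ifP => // t0.
by rewrite mulr_ge0 ?expR_ge0// exprn_ge0// invr_ge0 ltW.
Qed.

Lemma flat0_le1 t : flat 0 t <= 1.
Proof.
rewrite /flat; case: ifP => // t0; rewrite expr0 mul1r.
by rewrite -expR0 ler_expR oppr_le0 invr_ge0 ltW.
Qed.

Lemma flat_gt0 k t : 0 < t -> 0 < flat k t.
Proof. by move=> t0; rewrite /flat t0 mulr_gt0 ?expR_gt0// exprn_gt0// invr_gt0. Qed.

Lemma flat_le0 k t : t <= 0 -> flat k t = 0.
Proof. by move=> t0; rewrite /flat ltNge t0. Qed.

(** [exp y >= (y / n) ^ n] with [y = 1 / t] and [n = k + 2] leaves two powers of
    [t]: one for the difference quotient at 0, one for its limit to be 0. *)
Lemma flat_le_sqr k t : flat k t <= k.+2%:R ^+ k.+2 * t ^+ 2.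
Proof.
rewrite /flat; case: ifPn => [t0|_]; last first.
  by apply: mulr_ge0; [exact: exprn_ge0|exact: sqr_ge0].
set n := k.+2; have nR : 0 < n%:R :> R by rewrite ltr0n.
have h : (n%:R * t)^-1 ^+ n <= expR t^-1.
  have -> : t^-1 = n%:R * (n%:R * t)^-1.
    by rewrite invfM mulrA divff ?mul1r// gt_eqF.
  rewrite expRM_natl lerXn2r ?nnegrE ?expR_ge0 ?invr_ge0 ?mulr_ge0 ?(ltW t0)//.
  by rewrite (le_trans _ (expR_ge1Dx _))// lerDr.
have {}h : expR (- t^-1) <= (n%:R * t) ^+ n.
  rewrite expRN -[leRHS]invrK lef_pV2 ?posrE ?expR_gt0//.
    by rewrite -exprVn.
  by rewrite invr_gt0 exprn_gt0// mulr_gt0.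
have tk0 : 0 <= t^-1 ^+ k by rewrite exprn_ge0// invr_ge0 ltW.
apply: (le_trans (ler_wpM2l tk0 h)).
rewrite exprMn mulrCA ler_wpM2l ?exprn_ge0// /n -addn2 exprD mulrA -exprMn.
by rewrite mulVf ?gt_eqF// expr1n mul1r.
Qed.

Lemma is_derive_flat0 k : is_derive (0 : R) 1 (flat k) 0.
Proof.
have h : (fun h : R => h^-1 *: ((flat k \o shift 0) (h *: (1 : R)) - flat k 0))
    @ 0^' --> (0 : R).
  apply/cvgr0Pnorm_le => e e0.
  pose c := k.+2%:R ^+ k.+2 : R; have c0 : 0 < c by rewrite exprn_gt0// ltr0n.
  exists (e / c) => /=; first by rewrite divr_gt0.
  move=> z /=; rewrite sub0r normrN => ze z0.
  rewrite (flat_le0 _ (lexx 0)) subr0 /= addr0 /GRing.scale/= mulr1.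
  rewrite normrM normfV ger0_norm ?flat_ge0// mulrC ler_pdivrMr ?normr_gt0//.
  apply: (le_trans (flat_le_sqr k z)); rewrite -/c -(ger0_norm (sqr_ge0 z)) normrX.
  by rewrite expr2 mulrA ler_pM2r ?normr_gt0// mulrC -ler_pdivlMr// ltW.
apply: DeriveDef; last exact: (cvg_lim (@Rhausdorff R) h).
by apply/cvg_ex; exists 0.
Qed.

Lemma is_derive_flat k t :
  is_derive t 1 (flat k) (- k%:R * flat k.+1 t + flat k.+2 t).
Proof.
have [t0|t0|<-] := ltgtP 0 t; last 2 first.
- rewrite !flat_le0 ?(ltW t0)// mulr0 addr0.
  apply: (@near_eq_is_derive _ _ _ (cst (0 : R))).
  by near=> z; rewrite flat_le0// ltW//; near: z; exact: lt_nbhsl.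
- by rewrite !flat_le0// mulr0 addr0; exact: is_derive_flat0.
have tn0 : t != 0 by rewrite gt_eqF.
have dV : is_derive t 1 (fun z : R => z^-1) (- t ^- 2 *: 1).
  by apply: is_deriveV => //; exact: is_derive_id.
have dVN : is_derive t 1 (fun z : R => - z^-1) (- (- t ^- 2 *: 1)).
  exact: is_deriveN.
have dX := is_deriveX k dV.
have dE := @is_derive1_comp R expR (fun z : R => - z^-1) t _ _ (is_derive_expR (- t^-1)) dVN.
have d : is_derive t 1 (fun z : R => z^-1 ^+ k * expR (- z^-1))
    (- k%:R * flat k.+1 t + flat k.+2 t).
  have -> : (fun z : R => z^-1 ^+ k * expR (- z^-1)) =
    ((fun z : R => z^-1) ^+ k) * (expR \o (fun z : R => - z^-1)).
    by apply/funext => z; rewrite !fctE.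
  apply: (is_derive_eq (is_deriveM dX dE)); rewrite !fctE.
  rewrite /flat t0 /GRing.scale /= !mulr1 -!exprVn.
  case: k {dX} => [|k] /=; first by rewrite !exprS; ring.
  by rewrite !exprS; ring.
apply: near_eq_is_derive d.
by near=> z; rewrite /flat ifT//; near: z; exact: lt_nbhsr.
Unshelve. all: by end_near. Qed.

Lemma continuous_flat k : continuous (flat k).
Proof.
move=> t; apply: differentiable_continuous; apply/derivable1_diffP.
by have [] := is_derive_flat k t.
Qed.

End FlatFunctions.

(** * A derivation-stable algebra of smooth functions *)

Section FlatAlgebra.
Context (R : realType) (D : nat).
Notation E := 'rV[R]_D.

(** Generated by constants and flat functions of affine functions of one
    coordinate: large enough to contain bumps on cubes, and stable under partial
    derivatives, so that smoothness reduces to first derivatives. *)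
Inductive flat_algebra : (E -> R) -> Prop :=
| flat_cst (c : R) : flat_algebra (fun=> c)
| flat_atom k (a b : R) (i : 'I_D) : flat_algebra (fun x => flat k (a + b * x 0 i))
| flat_add f g : flat_algebra f -> flat_algebra g ->
    flat_algebra (fun x => f x + g x)
| flat_mul f g : flat_algebra f -> flat_algebra g ->
    flat_algebra (fun x => f x * g x).

Lemma affine_coordinate_cvg (a b : R) (i : 'I_D) (x : E) :
  a + b * (z : E) 0 i @[z --> x] --> a + b * x 0 i.
Proof.
have xi : (z : E) 0 i @[z --> x] --> x 0 i by exact: coordinate_continuous.
exact: (cvgD (cvg_cst a) (cvgM (cvg_cst b) xi)).
Qed.

Lemma flat_algebra_continuous f : flat_algebra f -> continuous f.
Proof.
elim=> [c|k a b i|{}f g _ cf _ cg|{}f g _ cf _ cg] x.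
- exact: (@cst_continuous _ _ c).
- apply: (@continuous_comp _ _ _ (fun z : E => a + b * z 0 i) (flat k) x).
    exact: affine_coordinate_cvg.
  exact: continuous_flat.
- exact: (cvgD (cf x) (cg x)).
- exact: (cvgM (cf x) (cg x)).
Qed.

(** Along the line [x + h e_j] the function is a function of [h] alone, to which
    the one-variable chain rule applies. *)
Lemma is_derive_affine_coordinate k (a b : R) (i j : 'I_D) (x : E) (df : R) :
  is_derive (a + b * x 0 i) 1 (flat k) df ->
  is_derive x (delta_mx 0 j : E) (fun x => flat k (a + b * x 0 i))
    (df * (b * (i == j)%:R)).
Proof.
move=> fd; pose c := b * (i == j)%:R.
pose p (h : R) := flat k (a + b * x 0 i + c * h).
have dp : is_derive (0 : R) 1 p (df * c).
  have dl : is_derive (0 : R) 1 (fun h : R => a + b * x 0 i + c * h) c.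
    have d1 : is_derive (0:R) 1 (c \*: (id : R -> R)) (c *: 1).
      exact: is_deriveZ.
    have d2 := is_deriveD (is_derive_cst (a + b * x 0 i) (0:R) 1) d1.
    by apply: (is_derive_eq d2); rewrite add0r /GRing.scale/= mulr1.
  apply: (@is_derive1_comp R (flat k) (fun h : R => a + b * x 0 i + c * h) 0 df c) => //.
  by rewrite mulr0 addr0.
have pE (h : R) : ((fun z : E => flat k (a + b * z 0 i)) \o shift x)
    (h *: (delta_mx 0 j : E)) =
    (p \o shift 0) (h *: 1).
  rewrite /= /p !mxE eqxx /= addr0 /c /GRing.scale /= mulr1; congr flat; ring.
have qE : (fun h : R => h^-1 *: (((fun z : E => flat k (a + b * z 0 i)) \o shift x)
      (h *: (delta_mx 0 j : E)) - flat k (a + b * x 0 i))) =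
    (fun h : R => h^-1 *: ((p \o shift 0) (h *: 1) - p 0)).
  by apply/funext => h; rewrite pE /p mulr0 addr0.
case: dp => dp1 dp2; apply: DeriveDef.
  by rewrite /derivable qE.
by rewrite /derive qE.
Qed.

Lemma flat_algebra_derive f (j : 'I_D) : flat_algebra f ->
  exists2 df, flat_algebra df &
    forall x : E, is_derive x (delta_mx 0 j : E) f (df x).
Proof.
elim=> [c|k a b i|{}f g fa [df dfa fd] ga [dg dga gd]|{}f g fa [df dfa fd] ga [dg dga gd]].
- exists (fun=> 0); first exact: flat_cst.
  by move=> x; exact: is_derive_cst.
- exists (fun x => (- k%:R * flat k.+1 (a + b * x 0 i) +
    flat k.+2 (a + b * x 0 i)) * (b * (i == j)%:R)).
    apply: flat_mul; last exact: flat_cst.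
    apply: flat_add; last exact: flat_atom.
    by apply: flat_mul; [exact: flat_cst|exact: flat_atom].
  move=> x; apply: is_derive_affine_coordinate; exact: is_derive_flat.
- exists (fun x => df x + dg x); first exact: flat_add.
  by move=> x; exact: (is_deriveD (fd x) (gd x)).
- exists (fun x => f x * dg x + g x * df x); last first.
    by move=> x; exact: (is_deriveM (fd x) (gd x)).
  by apply: flat_add; exact: flat_mul.
Qed.

(** Stability is used through an equality of functions: the iterated derivative
    belongs to the algebra, whence it is continuous and derivable. *)
Lemma flat_algebra_iter_partial f s : flat_algebra f ->
  flat_algebra (iter_partial s f).
Proof.
move=> fa; elim: s => //= i s ih.
have [df dfa fd] := flat_algebra_derive i ih.
suff -> : partial i (iter_partial s f) = df by [].
by apply/funext => x; rewrite /partial derive_val.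
Qed.

Lemma flat_algebra_Cdiff f N : flat_algebra f -> Cdiff N f.
Proof.
move=> fa s _; have sa := flat_algebra_iter_partial s fa.
split; first exact: flat_algebra_continuous.
by move=> i _ x; have [df _ fd] := flat_algebra_derive i sa; exact: ex_derive.
Qed.

Lemma flat_algebra_sum (I : Type) (s : seq I) (F : I -> E -> R) :
  (forall i, flat_algebra (F i)) -> flat_algebra (fun x => \sum_(i <- s) F i x).
Proof.
move=> h; elim: s => [|i s ih].
  rewrite (_ : (fun _ => _) = fun=> 0); first exact: flat_cst.
  by apply/funext => x; rewrite big_nil.
rewrite (_ : (fun _ => _) = (fun x => F i x + \sum_(i <- s) F i x)).
  exact: flat_add.
by apply/funext => x; rewrite big_cons.
Qed.

Lemma flat_algebra_prod (I : Type) (s : seq I) (F : I -> E -> R) :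
  (forall i, flat_algebra (F i)) -> flat_algebra (fun x => \prod_(i <- s) F i x).
Proof.
move=> h; elim: s => [|i s ih].
  rewrite (_ : (fun _ => _) = fun=> 1); first exact: flat_cst.
  by apply/funext => x; rewrite big_nil.
rewrite (_ : (fun _ => _) = (fun x => F i x * \prod_(i <- s) F i x)).
  exact: flat_mul.
by apply/funext => x; rewrite big_cons.
Qed.

Lemma flat_algebra_exp f n : flat_algebra f -> flat_algebra (fun x => f x ^+ n).
Proof.
move=> fa; elim: n => [|n ih]; first exact: (flat_cst 1).
rewrite (_ : (fun _ => _) = (fun x => f x * f x ^+ n)); first exact: flat_mul.
by apply/funext => x; rewrite exprS.
Qed.

Lemma flat_algebra_1B f : flat_algebra f -> flat_algebra (fun x => 1 - f x).
Proof.
move=> fa; rewrite (_ : (fun _ => _) = (fun x => 1 + (-1) * f x)).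
  by apply: flat_add; [exact: flat_cst|apply: flat_mul => //; exact: flat_cst].
by apply/funext => x; rewrite mulN1r.
Qed.

(** Positive exactly on [cube q e], and between 0 and 1. *)
Definition cube_bump (q : 'rV[rat]_D) (e : rat) (x : E) : R :=
  \prod_(i < D) (flat 0 (ratr e + ratr (q 0 i) + (-1) * x 0 i) *
                 flat 0 (ratr e - ratr (q 0 i) + 1 * x 0 i)).

Lemma flat_algebra_cube_bump q e : flat_algebra (cube_bump q e).
Proof.
apply: (@flat_algebra_prod _ _ (fun i x => flat 0 (ratr e + ratr (q 0 i) + (-1) * x 0 i) *
                 flat 0 (ratr e - ratr (q 0 i) + 1 * x 0 i))) => i.
by apply: flat_mul; exact: flat_atom.
Qed.

Lemma cube_bump_gt0 q e x : cube q e x -> 0 < cube_bump q e x.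
Proof.
move=> xc; apply: prodr_gt0 => i _; have := xc i.
rewrite ltr_norml => /andP[h1 h2].
by apply: mulr_gt0; apply: flat_gt0; lra.
Qed.

Lemma cube_bump_out q e x : cube_bump q e x != 0 -> cube q e x.
Proof.
move=> /prodf_neq0 h i; have := h i isT.
rewrite mulf_eq0 negb_or => /andP[h1 h2].
rewrite ltr_norml; apply/andP; split.
  by have [/(flat_le0 0)/eqP|] := leP (ratr e - ratr (q 0 i) + 1 * x 0 i) 0;
    [rewrite (negbTE h2)|move=> ?; lra].
by have [/(flat_le0 0)/eqP|] := leP (ratr e + ratr (q 0 i) + (-1) * x 0 i) 0;
    [rewrite (negbTE h1)|move=> ?; lra].
Qed.

Lemma cube_bump_ge0 q e x : 0 <= cube_bump q e x.
Proof. by apply: prodr_ge0 => i _; rewrite mulr_ge0 ?flat_ge0. Qed.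

Lemma cube_bump_le1 q e x : cube_bump q e x <= 1.
Proof.
apply: prodr_ile1 => i _; rewrite mulr_ge0 ?flat_ge0//=.
by apply: mulr_ile1; rewrite ?flat_ge0 ?flat0_le1.
Qed.

Lemma cube_bounded q e x : cube q e x ->
  `|x| <= \sum_(i < D) `|ratr (q 0 i) : R| + `|ratr e|.
Proof.
move=> xc; rewrite [leLHS]mx_normrE; apply: bigmax_le => [|[i j] _ /=].
  by rewrite addr_ge0// sumr_ge0.
rewrite (ord1 i) -[x 0 j](subrK (ratr (q 0 j))) (le_trans (ler_normD _ _))// addrC lerD//.
  by rewrite (bigD1 j)//= lerDl sumr_ge0.
by rewrite ltW// (lt_le_trans (xc j))// ler_norm.
Qed.

End FlatAlgebra.

(** * From smooth test functions to weak convergence *)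

Section VagueToWeak.
Context (R : realType) (D : nat).
Notation E := 'rV[R]_D.

Lemma bounded_support_compact (h : E -> R) (r : R) :
  (forall x, h x != 0 -> `|x| <= r) -> compact (closure [set x | h x != 0]).
Proof.
move=> hr; have sub : closure [set x | h x != 0] `<=` [set x : E | `|x| <= r].
  have cl : closed [set x : E | `|x| <= r].
    apply: (@closed_comp _ _ (fun x : E => `|x|) [set z | z <= r]); last exact: closed_le.
    by move=> x _; exact: norm_continuous.
  by rewrite closureE => x /(_ _ (conj cl _)); apply => y /= /hr.
apply: bounded_closed_compact; last exact: closed_closure.
exists r; split; first exact: num_real.
by move=> M rM x /sub /= xr; rewrite (le_trans xr)// ltW.
Qed.

(** [U] is the union of the rational cubes that it contains.  If [phi n] runs
    through their bumps, then [1 - (\prod_(n < N) (1 - phi n)) ^+ N] is supported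
    by finitely many of these cubes and tends to the indicator of [U]: at a point
    of [U] some factor is less than 1, and the exponent [N] drives the product
    to 0.  Conclude by dominated convergence. *)
Lemma open_inner_approximation (nu : probability E R) (U : set E) (eps : R) :
  open U -> 0 < eps ->
  exists h : E -> R, [/\ flat_algebra h, forall x, 0 <= h x <= 1,
    forall x, h x != 0 -> U x,
    exists r, forall x, h x != 0 -> `|x| <= r &
    fine (nu U) - eps <= \int[nu]_x h x].
Proof.
move=> oU eps0; have mU : measurable U by exact: open_measurable_row.
pose phi n : E -> R := if @unpickle ('rV[rat]_D * rat)%type n is Some (q, e) then
  if `[< cube q e `<=` U >] then cube_bump q e else fun=> 0 else fun=> 0.
have phi_flat n : flat_algebra (phi n).
  rewrite /phi; case: unpickle => [[q e]|]; last exact: flat_cst.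
  by case: ifP => _; [exact: flat_algebra_cube_bump|exact: flat_cst].
have phi0 n x : 0 <= phi n x.
  rewrite /phi; case: unpickle => [[q e]|]//.
  by case: ifP => _ //; exact: cube_bump_ge0.
have phi1 n x : phi n x <= 1.
  rewrite /phi; case: unpickle => [[q e]|]//.
  by case: ifP => _ //; exact: cube_bump_le1.
have phiU n x : phi n x != 0 -> U x.
  rewrite /phi; case: unpickle => [[q e]|]; rewrite ?eqxx//.
  by case: ifPn => [/asboolP qU /cube_bump_out/qU//|]; rewrite eqxx.
have /choice[r rP] n : exists r : R, forall x, phi n x != 0 -> `|x| <= r.
  rewrite /phi; case: unpickle => [[q e]|]; last by exists 0 => x; rewrite eqxx.
  case: ifPn => _; last by exists 0 => x; rewrite eqxx.
  by eexists => x /cube_bump_out/cube_bounded; apply.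
have Uphi x : U x -> exists n, 0 < phi n x.
  move=> /(open_rational_cube oU)[q [e [xqe qeU]]]; exists (pickle (q, e)).
  by rewrite /phi pickleK ifT ?cube_bump_gt0//; exact/asboolP.
pose p N x := \prod_(n <- index_iota 0 N) (1 - phi n x).
have p0 N x : 0 <= p N x by apply: prodr_ge0 => n _; rewrite subr_ge0.
have p1 N x : p N x <= 1.
  by apply: prodr_ile1 => n _; rewrite subr_ge0 phi1 gerBl phi0.
pose h N x := 1 - p N x ^+ N.
have h_flat N : flat_algebra (h N).
  apply: flat_algebra_1B; apply: flat_algebra_exp.
  by apply: (@flat_algebra_prod _ _ _ _ (fun n x => 1 - phi n x)) => n; exact: flat_algebra_1B.
have h01 N x : 0 <= h N x <= 1.
  by rewrite subr_ge0 gerBl exprn_ge0// andbT exprn_ile1.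
have hphi N x : h N x != 0 -> exists2 n, (n < N)%N & phi n x != 0.
  move=> hx; apply: contrapT => /forall2NP hn; move/negP: hx; apply.
  rewrite /h /p big1_seq ?expr1n ?subrr// => n /andP[_].
  rewrite mem_index_iota => /andP[_ nN].
  have [/(_ nN)//|/negP] := hn n; by rewrite negbK => /eqP ->; rewrite subr0.
have hU N x : h N x != 0 -> U x by move=> /hphi[n _ /phiU].
have hr N x : h N x != 0 -> `|x| <= \sum_(n <- index_iota 0 N) `|r n|.
  move=> /hphi[n nN /rP xr]; rewrite (le_trans xr)// (le_trans (ler_norm _))//.
  by rewrite (big_rem n)/= ?mem_index_iota// lerDl sumr_ge0.
have hb N : mbounded 1 (h N).
  split=> [|x]; last by case/andP: (h01 N x) => a b; rewrite ger0_norm.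
  by apply: continuous_measurable_row; exact: flat_algebra_continuous.
have hcvg x : h N x @[N --> \oo] --> (\1_U x : R).
  rewrite indicE; have [/set_mem xU|/negP xU] := boolP (x \in U); last first.
    apply: cvg_near_cst; apply: nearW => N; apply/eqP/negbNE/negP => /hU.
    by move=> Ux; apply: xU; exact/mem_set.
  have [m mx] := Uphi _ xU; pose c := 1 - phi m x.
  have c0 : 0 <= c by rewrite subr_ge0.
  have c1 : c < 1 by rewrite gtrBl.
  have : 1 - c ^+ N @[N --> \oo] --> (1 : R) - 0.
    by apply: cvgB; [exact: cvg_cst|apply: cvg_expr; rewrite ger0_norm].
  rewrite subr0 => cc; apply: (squeeze_cvgr _ cc (cvg_cst _)).
  exists m.+1 => // N /= mN; case/andP: (h01 N x) => _ ->; rewrite andbT.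
  rewrite lerB// lerXn2r ?nnegrE//.
  rewrite /p (big_rem m)/= ?mem_index_iota//.
  rewrite -[leRHS]mulr1 ler_wpM2l//; apply: prodr_ile1 => n _.
  by rewrite subr_ge0 phi1 gerBl phi0.
have icvg : \int[nu]_x h N x @[N --> \oo] --> fine (nu U).
  have [_ _ lim] := @dominated_convergence _ _ _ nu setT measurableT
    (fun N x => (h N x)%:E) (fun x => (\1_U x)%:E) (cst 1%E)
    (fun N => (measurable_EFinP _ _).2 (hb N).1)
    (ltac:(apply/measurable_EFinP; exact: measurable_indic))
    (ltac:(apply: aeW => x _; apply: cvg_EFin; [exact: nearW|exact: hcvg]))
    (ltac:(exact: (finite_measure_integrable_cst nu 1)))
    (ltac:(apply: aeW => x N _; rewrite lee_fin; exact: (hb N).2)).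
  rewrite integral_indic// setIT in lim.
  have nuU : nu U = (fine (nu U))%:E by rewrite fineK// fin_num_measure.
  have lim' : (\int[nu]_x (h N x)%:E)%E @[N --> \oo] --> (fine (nu U))%:E.
    by rewrite -nuU; exact: lim.
  exact: (fine_cvg lim').
have /cvgrPdist_le/(_ _ eps0)[N _ /(_ N (leqnn N))/= NP] := icvg.
exists (h N); split => //; first by exact: hU.
  by eexists; exact: hr.
by rewrite lerBlDl -lerBlDr (le_trans (ler_norm _)).
Qed.

(** Between [y - 1] and [y] if [0 <= y <= n]; the other bounds make the induction
    on [n] work. *)
Lemma count_below n (y : R) :
  let cnt := \sum_(0 <= i < n) (i.+1%:R < y)%R%:R : R in
  Num.min (y - 1) n%:R <= cnt /\ (0 <= y -> cnt <= y) /\ cnt <= n%:R.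
Proof.
elim: n => [|n [ih1 [ih2 ih3]]] /=.
  by rewrite big_geq// ge_min lexx orbT; split.
rewrite big_nat_recr//=; set c := \sum_(0 <= i < n) _ in ih1 ih2 ih3 *.
have nS : n.+1%:R = n%:R + 1 :> R by rewrite -natr1.
have [yn|yn] := ltP n.+1%:R y => /=.
  rewrite mulr1n nS; split; last by split => [_|]; rewrite ?lerD2r//; lra.
  have := ih1; rewrite min_r; last by lra.
  by move=> nc; rewrite ge_min; apply/orP; right; rewrite lerD2r.
rewrite mulr0n addr0; split; last by split => //; lra.
by move: ih1; rewrite !ge_min => /orP[->//|nc]; apply/orP; left; lra.
Qed.

Lemma Rint_sum (nu : probability E R) n (F : nat -> E -> R) :
  (forall i, mbounded 1 (F i)) ->
  mbounded n%:R (fun x => \sum_(0 <= i < n) F i x) /\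
  \int[nu]_x (\sum_(0 <= i < n) F i x) = \sum_(0 <= i < n) \int[nu]_x F i x.
Proof.
move=> bF; elim: n => [|n [b ih]].
  have -> : (fun x => \sum_(0 <= i < 0) F i x) = fun=> 0.
    by apply/funext => x; rewrite big_geq.
  split; first by have := @mbounded_cst _ E R 0; rewrite normr0.
  by rewrite big_geq// (Rint_cst (probability_setT nu)).
have -> : (fun x => \sum_(0 <= i < n.+1) F i x) =
    (fun x => \sum_(0 <= i < n) F i x + F n x).
  by apply/funext => x; rewrite big_nat_recr.
split; first by rewrite -natr1; exact: mboundedD.
by rewrite (RintD (probability_setT nu) b (bF n)) ih big_nat_recr.
Qed.

(** Layers: the average of the indicators of [g > i / N], [1 <= i <= N], lies
    between [g - 1 / N] and [g], and each of these open sets is approximated from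
    inside by a smooth function. *)
Lemma smooth_minorant (nu : probability E R) (g : E -> R) (eps : R) :
  continuous g -> (forall x, 0 <= g x <= 1) -> 0 < eps ->
  exists h : E -> R, [/\ smooth_compact_support h, forall x, 0 <= h x <= g x &
    \int[nu]_x g x - eps <= \int[nu]_x h x].
Proof.
move=> cg g01 eps0; have e20 : 0 < eps / 2 by rewrite divr_gt0.
have [n /andP[n0 n2]] := small_div ltr01 e20.
set N := n.+1 in n0 n2; have N0 : 0 < N%:R :> R by rewrite ltr0n.
pose U i := [set x : E | i.+1%:R / N%:R < g x].
have oU i : open (U i).
  apply: (@open_comp _ _ g [set z | i.+1%:R / N%:R < z]); last exact: open_gt.
  by move=> x _; exact: cg.
have /choice[hh hP] i := open_inner_approximation nu (oU i) e20.
have hb i : mbounded 1 (hh i).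
  have [ha h01 _ _ _] := hP i.
  split=> [|x]; last by case/andP: (h01 x) => a b; rewrite ger0_norm.
  by apply: continuous_measurable_row; exact: flat_algebra_continuous.
have ub i : mbounded 1 (\1_(U i) : E -> R).
  split; first by apply: measurable_indic; exact: open_measurable_row.
  by move=> x; rewrite indicE; case: (x \in U i); rewrite ?normr1 ?normr0.
have Ux i x : (\1_(U i) x : R) = (i.+1%:R < N%:R * g x)%R%:R.
  rewrite indicE; congr (_%:R); congr nat_of_bool.
  rewrite mulrC -ltr_pdivrMr//; apply/idP/idP => [/set_mem//|?]; exact/mem_set.
have hle x i : hh i x <= \1_(U i) x.
  have [_ h01 hU _ _] := hP i; case/andP: (h01 x) => a b.
  rewrite indicE; have [//|xU] := boolP (x \in U i).
  have [->//|/hU Uix] := eqVneq (hh i x) 0.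
  by move: xU; rewrite (mem_set Uix).
pose S x := \sum_(0 <= i < N) hh i x.
pose h x := N%:R^-1 * S x.
have [Sb Si] := Rint_sum nu N hb.
have [Tb Ti] := Rint_sum nu N ub.
exists h; split.
- split.
    move=> M; apply: flat_algebra_Cdiff; apply: flat_mul; first exact: flat_cst.
    by apply: flat_algebra_sum => i; have [] := hP i.
  have /choice[r rP] i : exists r, forall x, hh i x != 0 -> `|x| <= r.
    by have [_ _ _ ? _] := hP i.
  apply: (@bounded_support_compact _ (\sum_(0 <= i < N) `|r i|)) => x hx.
  have [i iN hi] : exists2 i, (i < N)%N & hh i x != 0.
    apply: contrapT => /forall2NP hn; move/negP: hx; apply.
    rewrite /h /S big1_seq ?mulr0// => i /andP[_].
    rewrite mem_index_iota => /andP[_ iN].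
    by have [/(_ iN)//|/negP] := hn i; rewrite negbK => /eqP.
  rewrite (le_trans (rP _ _ hi))// (le_trans (ler_norm _))//.
  by rewrite (big_rem i)/= ?mem_index_iota// lerDl sumr_ge0.
- move=> x; apply/andP; split.
    rewrite mulr_ge0 ?invr_ge0// ?sumr_ge0// => i _.
    by have [_ /(_ x)/andP[]] := hP i.
  rewrite /h ler_pdivrMl//.
  have [_ [+ _]] := count_below N (N%:R * g x).
  have gx0 : 0 <= g x by case/andP: (g01 x).
  move=> /(_ (mulr_ge0 (ltW N0) gx0)); apply: le_trans.
  by apply: ler_sum => i _; rewrite -Ux.
have bg : mbounded 1 g.
  split; first exact: continuous_measurable_row.
  by move=> x; case/andP: (g01 x) => a b; rewrite ger0_norm.
have nu1 := probability_setT nu.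
have bc := @mbounded_cst _ E R N%:R^-1.
rewrite /h (RintZ nu1 _ Sb) Si.
have lo : \int[nu]_x (g x - N%:R^-1) <= \int[nu]_x (N%:R^-1 * \sum_(0 <= i < N) \1_(U i) x).
  apply: (ler_Rint nu1 (mboundedB bg bc) (mboundedZ N%:R^-1 Tb)) => x.
  rewrite ler_pdivlMl// mulrBr divff ?gt_eqF//.
  have [+ _] := count_below N (N%:R * g x).
  under eq_bigr do rewrite -Ux.
  rewrite min_l//; case/andP: (g01 x) => _ gx1.
  by rewrite lerBlDr (le_trans (ler_wpM2l (ltW N0) gx1))// mulr1 lerDl.
move: lo; rewrite (RintB nu1 bg bc) (Rint_cst nu1) (RintZ nu1 _ Tb) Ti => lo.
have hi : N%:R^-1 * \sum_(0 <= i < N) \int[nu]_x \1_(U i) x <=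
    N%:R^-1 * \sum_(0 <= i < N) \int[nu]_x hh i x + eps / 2.
  rewrite -lerBlDl -mulrBr ler_pdivrMl//.
  rewrite -sumrB (_ : N%:R * (eps / 2) = \sum_(0 <= i < N) (eps / 2)); last first.
    by rewrite sumr_const_nat subn0 mulr_natl.
  apply: ler_sum => i _; rewrite lerBlDl -lerBlDr.
  have [_ _ _ _] := hP i; congr (_ - _ <= _).
  by rewrite /Rintegral integral_indic ?setIT//; exact: open_measurable_row.
rewrite mul1r in n2; lra.
Qed.

(** A smooth minorant [h] of [f] with almost the same integral for [nu] gives
    [\int[mu i] f >= \int[mu i] h -> \int[nu] h], hence the lower bound; it is
    applied to [f] and to [- f].  As the measures have mass 1, [f] can first be
    rescaled to have values in [[0, 1]]. *)
Lemma weak_cvg_of_smooth (I : Type) (F : set_system I) (FF : Filter F)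
    (mu : I -> probability E R) (nu : probability E R) :
  (forall h, smooth_compact_support h -> (exists M, mbounded M h) ->
     \int[mu i]_x h x @[i --> F] --> \int[nu]_x h x) ->
  weak_cvg F (fun i => mu i) nu.
Proof.
move=> hcvg.
have low (f : E -> R) (M : R) : continuous f -> (forall x, `|f x| <= M) ->
    forall e, 0 < e -> \forall i \near F, \int[nu]_x f x - e <= \int[mu i]_x f x.
  move=> cf fM e e0; pose M' := `|M| + 1.
  have M'0 : 0 < M' by rewrite /M' ltr_pwDr.
  have fM' x : `|f x| <= M'.
    by rewrite (le_trans (fM x))// (le_trans (ler_norm _))// /M' lerDl.
  have bf : mbounded M' f by split=> //; exact: continuous_measurable_row.
  have bM := @mbounded_cst _ E R M'.
  pose g x := (2 * M')^-1 * (f x + M').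
  have M20 : 0 < 2 * M' by rewrite mulr_gt0.
  have bg := mboundedZ (2 * M')^-1 (mboundedD bf bM).
  have gE (m : probability E R) : \int[m]_x g x = (2 * M')^-1 * (\int[m]_x f x + M').
    rewrite /g (RintZ (probability_setT m) _ (mboundedD bf bM)).
    by rewrite (RintD (probability_setT m) bf bM) (Rint_cst (probability_setT m)).
  have cg : continuous g.
    by move=> x; exact: (cvgM (cvg_cst _) (cvgD (cf x) (cvg_cst _))).
  have g01 x : 0 <= g x <= 1.
    have := fM' x; rewrite ler_norml => /andP[a b].
    rewrite /g mulr_ge0 ?invr_ge0 ?(ltW M20)//=; last by lra.
    by rewrite ler_pdivrMl// mulr1; lra.
  have e40 : 0 < e / (4 * M') by rewrite divr_gt0// mulr_gt0.
  have [h [hs hg hi]] := smooth_minorant nu cg g01 e40.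
  have bh : mbounded 1 h.
    split; first by apply: continuous_measurable_row;
      have [/(_ (fun=> 0%N) [::])[]] := hs.
    by move=> x; case/andP: (hg x) (g01 x) => a b /andP[_ c]; rewrite ger0_norm// (le_trans b).
  have := hcvg h hs (ex_intro (fun M0 : R => mbounded M0 h) 1 bh) => /cvgrPdist_le/(_ _ e40).
  apply: filterS => i; set a := \int[nu]_x h x in hi *; set b := \int[mu i]_x h x.
  move=> /(le_trans (ler_norm _)) ab.
  have bgi : b <= \int[mu i]_x g x.
    by apply: (ler_Rint (probability_setT (mu i)) bh bg) => x; case/andP: (hg x).
  move: hi bgi; rewrite !gE ler_pdivlMl// => hi bgi.
  have ee : 2 * M' * (e / (4 * M')) = e / 2 by field; rewrite gt_eqF.
  have h2 : 2 * M' * (a - b) <= e / 2 by rewrite -ee ler_pM2l.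
  have h1 : \int[nu]_x f x + M' - e / 2 <= 2 * M' * a.
    have := ler_wpM2l (ltW M20) hi.
    by rewrite mulrBr (mulVKf (lt0r_neq0 M20)) ee.
  lra.
move=> f cf [M fM].
have bf : mbounded M f by split=> //; exact: continuous_measurable_row.
rewrite (RintE (probability_setT nu) bf).
have -> : (fun i => (\int[mu i]_x (f x)%:E)%E) = (fun i => (\int[mu i]_x f x)%:E).
  by apply/funext => i; rewrite (RintE (probability_setT (mu i)) bf).
apply: cvg_EFin; first exact: nearW.
apply/cvgrPdist_le => e e0.
have h1 := low f M cf fM e e0.
have h2 : \forall i \near F, \int[nu]_x (-1 * f x) - e <= \int[mu i]_x (-1 * f x).
  apply: (low _ M) => //.
    by move=> x; exact: (cvgM (cvg_cst _) (cf x)).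
  by move=> x; rewrite mulN1r normrN.
apply: filterS2 h1 h2 => i.
rewrite (RintZ (probability_setT nu) _ bf) (RintZ (probability_setT (mu i)) _ bf).
set p := \int[nu]_x f x; set q := \int[mu i]_x f x => a b.
by rewrite ler_norml /= -/q; apply/andP; split; lra.
Qed.

End VagueToWeak.

(** * Weak convergence of the interpolated laws *)

Section WeakConvergence.
Context (R : realType) (D : nat).
Notation E := 'rV[R]_D.
Context (gamma epsilon : nat -> R) (hgamma : step_sequence gamma)
  (hepsilon : nonincreasing_to0 epsilon)
  (P : R -> R.-pker E ~> E) (mu : R -> probability E R)
  (F : set (E -> R)) (F1 : forall f, F f -> mbounded 1 f) (C : R -> R) (A : R).
Hypothesis A0 : 0 <= A.
Hypothesis flow_approx : forall f s t T, F f -> 0 <= s -> 0 <= t ->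
  (1 <= step_index gamma t)%N -> s + gamma 1 <= T ->
  `|\int[mu (t + s)]_x f x - \int[flow P (mu t) s]_x f x| <=
  A * (1 + T * (1 + cplus C T)) * mesh gamma epsilon (step_index gamma t).

Lemma mesh_small (e : R) : 0 < e -> exists2 T0 : R, 0 <= T0 & forall t, T0 <= t ->
  (1 <= step_index gamma t)%N /\ mesh gamma epsilon (step_index gamma t) <= e.
Proof.
move=> e0; have [_ [_ glim] _] := hgamma; have [_ elim] := hepsilon.
have [N1 _ N1P] : \forall n \near \oo, gamma n <= e by exact: (cvgr_le 0).
have [N2 _ N2P] : \forall n \near \oo, epsilon n <= e by exact: (cvgr_le 0).
pose N := maxn 1 (maxn N1 N2).
exists (tau gamma N); first exact: tau_ge0.
move=> t /(step_index_ge hgamma) Nt; split; first exact: leq_trans (leq_maxl _ _) Nt.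
have NN : (maxn N1 N2 <= step_index gamma t)%N by exact: leq_trans (leq_maxr _ _) Nt.
rewrite ge_max; apply/andP; split.
  by apply: N1P => /=; exact: leq_trans (leq_maxl _ _) NN.
by apply: N2P => /=; exact: leq_trans (leq_maxr _ _) NN.
Qed.

Variables (pi : probability E R) (G : set (E -> R)) (psi : R -> R) (w : R).
Hypothesis psi0 : forall t, 0 <= t -> 0 <= psi t.
Hypothesis psi_cvg : psi t @[t --> +oo] --> (0 : R).
Hypothesis w0 : 0 <= w.
Hypothesis flow_dist : forall s t, 0 <= s -> 0 <= t ->
  (dist G (flow P (mu s) t) pi <= (w * psi t)%:E)%E.
Hypothesis dist_weak :
  forall (nus : nat -> probability E R) (nu : probability E R),
      dist G (nus n) nu @[n --> \oo] --> 0%E ->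
      weak_cvg \oo (fun n => nus n) nu.

(** Otherwise there is for each [n] a bad starting law [mu (s n)]; the laws
    [flow P (mu (s n)) n] tend to [pi] for the distance, hence weakly, and this
    contradicts their being bad. *)
Lemma flow_uniform_cvg (f : E -> R) M (e : R) :
  continuous f -> mbounded M f -> 0 < e ->
  exists n : nat, forall s, 0 <= s ->
    `|\int[flow P (mu s) n%:R]_x f x - \int[pi]_x f x| <= e.
Proof.
move=> cf bf e0; apply: contrapT => /forallNP h.
have /choice[s sP] n : exists s : R, 0 <= s /\
    e < `|\int[flow P (mu s) n%:R]_x f x - \int[pi]_x f x|.
  by have /existsNP[s /not_implyP[s0 /negP]] := h n; rewrite -ltNge => ?; exists s.
pose nus n := flow P (mu (s n)) n%:R.
have dcvg : dist G (nus n) pi @[n --> \oo] --> 0%E.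
  apply/(ge0_cvge0P _ (fun n => dist_ge0 _ _ _)) => d d0.
  have dw : 0 < d / (w + 1) by rewrite divr_gt0// ltr_wpDl.
  have [T0 [_ T0P]] := (cvgr_le _ psi_cvg) _ dw.
  have /archi_boundP := normr_ge0 T0; set N := Num.bound _ => NP.
  exists N => // n /= Nn.
  have n0 : 0 <= n%:R :> R by exact: ler0n.
  apply: (le_trans (flow_dist (sP n).1 n0)); rewrite lee_fin.
  have pn : psi n%:R <= d / (w + 1).
    apply: T0P; rewrite (le_lt_trans (ler_norm _))// (lt_le_trans NP)// ler_nat//.
  rewrite (le_trans (ler_wpM2l w0 pn))// mulrCA ler_piMr ?(ltW d0)//.
  by rewrite ler_pdivrMr ?ltr_wpDl// mul1r lerDl.
have := dist_weak dcvg cf (ex_intro _ M bf.2).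
rewrite (RintE (probability_setT pi) bf) => lim.
have lim' : (\int[nus n]_x f x)%:E @[n --> \oo] --> (\int[pi]_x f x)%:E.
  apply: cvg_trans lim; apply: near_eq_cvg; apply: nearW => n.
  by rewrite (RintE (probability_setT (nus n)) bf).
have lim'' : \int[nus n]_x f x @[n --> \oo] --> \int[pi]_x f x.
  exact: (fine_cvg lim').
have /cvgrPdist_le/(_ _ e0)[N _ /(_ N (leqnn N))/=] := lim''.
by rewrite distrC leNgt (sP N).2.
Qed.

(** First fix the length [n] of a window at the end of which the flow is close to
    [pi]; over a window of fixed length the approximation error tends to 0. *)
Lemma law_cvg (f : E -> R) : F f -> continuous f ->
  \int[mu t]_x f x @[t --> +oo] --> \int[pi]_x f x.
Proof.
move=> Ff cf; apply/cvgrPdist_le => e e0.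
have bf := F1 Ff; have e20 : 0 < e / 2 by rewrite divr_gt0.
have [n nP] := flow_uniform_cvg cf bf e20.
have n0 : 0 <= n%:R :> R by exact: ler0n.
pose T := n%:R + gamma 1; pose c := A * (1 + T * (1 + cplus C T)).
have g1 : 0 < gamma 1 by exact: (step_gt0 hgamma).
have T0 : 0 <= T by rewrite addr_ge0// ltW.
have c0 : 0 <= c.
  by rewrite mulr_ge0// addr_ge0// mulr_ge0// addr_ge0// le_max lexx orbT.
have ce : 0 < e / 2 / (c + 1) by rewrite divr_gt0// ltr_wpDl.
have [T1 T10 T1P] := mesh_small ce.
exists (T1 + n%:R); split; first exact: num_real.
move=> t tT /=; pose s := t - n%:R.
have T1s : T1 <= s by rewrite lerBrDr ltW.
have s0 : 0 <= s by exact: le_trans T1s.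
have [m1 me] := T1P s T1s.
have := flow_approx Ff n0 s0 m1 (lexx T); rewrite -/T -/c.
have -> : s + n%:R = t by rewrite subrK.
set x := Rintegral _ _ _; set z := Rintegral _ _ _ => xz.
have := nP s s0; rewrite -/z; set p := Rintegral _ _ _ => zp.
have xz2 : `|x - z| <= e / 2.
  rewrite (le_trans xz)// (le_trans (ler_wpM2l c0 me))// mulrCA ler_piMr ?(ltW e20)//.
  by rewrite ler_pdivrMr ?ltr_wpDl// mul1r lerDl.
rewrite distrC; have -> : x - p = (x - z) + (z - p) by ring.
by rewrite (splitr e) (le_trans (ler_normD _ _))// lerD.
Qed.

Lemma weak_convergence :
  (forall g : E -> R, smooth_compact_support g ->
      exists2 l : R, 0 < l & F (fun x => l * g x)) ->
  weak_cvg +oo (fun t => mu t) pi.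
Proof.
move=> Fsmooth; apply: weak_cvg_of_smooth => h hs [M bh].
have [l l0 Fl] := Fsmooth h hs.
have ch : continuous h by have [/(_ (fun=> 0%N) [::])[]] := hs.
have cl : continuous (fun x => l * h x) by move=> x; exact: (cvgM (cvg_cst _) (ch x)).
have lim := law_cvg Fl cl.
have hE (m : probability E R) : \int[m]_x h x = l^-1 * \int[m]_x (l * h x).
  by rewrite (RintZ (probability_setT m) _ bh) mulKf// gt_eqF.
rewrite hE; under eq_fun do rewrite hE.
exact: (cvgM (cvg_cst _) lim).
Qed.

End WeakConvergence.

(** * The theorem *)

Theorem theorem2p8 (R : realType) (D : nat)
  (* limit process *)
  (dX : measure_display) (OmegaX : measurableType dX)
  (PP : 'rV[R]_D -> probability OmegaX R) (X : R -> OmegaX -> 'rV[R]_D)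
  (P : R -> R.-pker 'rV[R]_D ~> 'rV[R]_D)
  (hX : markov_process PP X P)
  (* chain *)
  (dy : measure_display) (Omega : measurableType dy) (Pr : probability Omega R)
  (y : nat -> {RV Pr >-> 'rV[R]_D}) (K : nat -> R.-pker 'rV[R]_D ~> 'rV[R]_D)
  (hy : markov_chain y K)
  (gamma : nat -> R) (hgamma : step_sequence gamma)
  (d1 N1 N2 : 'I_D -> nat) (hN : mle N1 N2)
  (* (1) *)
  (epsilon : nat -> R) (hepsilon : nonincreasing_to0 epsilon)
  (h1 : exists M1 : R, forall f : 'rV[R]_D -> R, dom P f -> Cbdiff N1 f ->
     forall (n : nat) (x : 'rV[R]_D), (1 <= n)%N ->
       Supp (distribution Pr (y n)) x ->
       (`| (gen P f x)%:E - chain_gen gamma K n f x |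
          <= (M1 * chi d1 x)%:E * Cnorm N1 f * (epsilon n)%:E)%E)
  (* (2) *)
  (C : R -> R)
  (h2 : forall T : R, 0 < T -> forall t : R, 0 <= t <= T ->
     forall f : 'rV[R]_D -> R, Cbdiff N2 f ->
       Cbdiff N1 (sg P t f) /\
       (forall j : 'I_D -> nat, mle j N1 -> forall x : 'rV[R]_D,
          ((`| mderiv j (sg P t f) x |)%:E <= (C T)%:E * Cnorm N2 f)%E))
  (* (3) *)
  (h3 : exists2 d : 'I_D -> nat, mle d1 d &
     (exists M2 : R, forall n : nat, ('E_Pr[chi d \o y n] <= M2%:E)%E)
     \/
     (exists V : 'rV[R]_D -> R,
        [/\ measurable_fun setT V,
            forall x, 0 <= V x,
            forall n : nat, ('E_Pr[V \o y n] < +oo)%E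
          & exists (n0 : nat) (a alpha beta : R),
              [/\ (1 <= n0)%N, 0 < a, 0 < alpha & 0 < beta] /\
              (forall x, a < `|x| -> chi d x <= V x) /\
              (forall (n : nat) (x : 'rV[R]_D), (n0 <= n)%N ->
                 Supp (distribution Pr (y n)) x ->
                 (chain_gen gamma K n V x <= (- alpha * V x + beta)%:E)%E)]))
  (pi : probability 'rV[R]_D R) (v M3 : R) (hv : 0 < v) (hM3 : 0 < M3)
  (G : set ('rV[R]_D -> R)) :
  let F := classF P N2 in
  let mu := interp_law gamma y in
  let lam := lambda gamma epsilon in
  [/\
  (* (i) *)
   G `<=` F ->
   (forall (nu : probability 'rV[R]_D R) (t : R), 0 < t ->
      (dist G (flow P nu t) pi <= dist G nu pi * (M3 * expR (- v * t))%:E)%E) ->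
   (0 < lam)%E ->
   forall u : R, (u%:E < Order.min lam v%:E)%E ->
   exists M5 : R, forall t : R, (v - u)^-1 * ln (Num.max 1 M3) < t ->
     (dist G (mu t) pi <= (M5%:E + dist G (mu 0%R) pi) * (expR (- u * t))%:E)%E,

  (* (ii) *)
   forall r M4 : R, 0 < r -> 0 < M4 ->
   (forall s t : R, 0 < s -> 0 < t ->
      (dist G (flow P (mu s) t) pi <= (M3 * expR (- v * t))%:E)%E) ->
   (forall T : R, 0 < T -> T * C T <= M4 * expR (r * T)) ->
   (0 < lam)%E ->
   forall u : R, (u%:E < rate r v lam)%E ->
   exists M5 : R, forall t : R, 0 < t ->
     (dist (F `&` G) (mu t) pi <= (M5 * expR (- u * t))%:E)%E

  (* (iii) *)
  & forall (psi : R -> R) (W : 'rV[R]_D -> R),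
   (forall g : 'rV[R]_D -> R, smooth_compact_support g ->
      exists2 l : R, 0 < l & F (fun x => l * g x)) ->
   (forall t : R, 0 <= t -> 0 <= psi t) ->
   Cdiff (fun=> 0%N) W ->
   psi t @[t --> +oo] --> (0 : R) ->
   (forall A : R, exists B : R, forall x : 'rV[R]_D, B < `|x| -> A < W x) ->
   (ereal_sup [set 'E_Pr[W \o y n] | n in setT] < +oo)%E ->
   (forall (nu : probability 'rV[R]_D R) (t : R), 0 <= t ->
      (dist G (flow P nu t) pi <= \int[nu]_x (W x)%:E * (psi t)%:E)%E) ->
   (forall (nus : nat -> probability 'rV[R]_D R) (nu : probability 'rV[R]_D R),
      dist G (nus n) nu @[n --> \oo] --> 0%E ->
      weak_cvg \oo (fun n => nus n) nu) ->
   weak_cvg +oo (fun t => mu t) pi].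
Proof.
move=> F mu lam.
have CK := markov_process_chapman_kolmogorov hX.
have [B B0 hB] := chi_moments hy hgamma h3.
have [M1 h1'] := h1.
pose A := approx_const N1 M1 B.
have A0 : 0 <= A.
  by rewrite /A /approx_const addr_ge0// mulr_ge0 ?ler0n// mulr_ge0.
have F1 f : F f -> mbounded 1 f by move=> /classF_bounds[[]].
have approx f s t T : F f -> 0 <= s -> 0 <= t ->
    (1 <= step_index gamma t)%N -> s + gamma 1 <= T ->
    `|\int[mu (t + s)]_x f x - \int[flow P (mu t) s]_x f x| <=
    A * (1 + T * (1 + cplus C T)) * mesh gamma epsilon (step_index gamma t).
  by apply: (flow_approximation CK hy hgamma hepsilon h1' h2 B0 hB).
split.
- exact: (contraction_rate hgamma F1 A0 approx hM3).
- move=> r M4 r0 M40 erg CT lam0.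
  exact: (uniform_ergodicity_rate hgamma F1 A0 approx hv hM3 r0 M40 erg CT lam0).
move=> psi W Fsmooth psi0 W0 psi_cvg _ Wsup Wdist dist_weak.
pose w := Num.max 0 (fine (ereal_sup [set 'E_Pr[W \o y n] | n in setT])%E).
have w0 : 0 <= w by rewrite le_max lexx.
have mW : measurable_fun setT W.
  by apply: continuous_measurable_row; have [] := W0 [::] (fun=> leqnn 0).
have Ww n : (\int[distribution Pr (y n)]_x (W x)%:E <= w%:E)%E.
  rewrite -expectation_law//.
  have : ('E_Pr[W \o y n] <= ereal_sup [set 'E_Pr[W \o y n] | n in setT])%E.
    by apply: ereal_sup_ubound; exists n.
  move=> /le_trans; apply; rewrite /w; move: Wsup.
  case: ereal_sup => [r _|//|_]; last exact: leNye.
  by rewrite lee_fin le_max lexx orbT.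
have fd s t : 0 <= s -> 0 <= t -> (dist G (flow P (mu s) t) pi <= (w * psi t)%:E)%E.
  move=> s0 t0; apply: (le_trans (Wdist (mu s) t t0)).
  rewrite EFinM; apply: lee_wpmul2r; first by rewrite lee_fin psi0.
  exact: Ww.
exact: (weak_convergence hgamma hepsilon F1 A0 approx psi_cvg w0 fd dist_weak Fsmooth).
Qed.
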